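(* Let $F$ be an algebraically closed field of characteristic zero which has infinite transcendence degree over $\mathbb{Q}$. Let $G$ be a Chevalley group over $F$ of type $B_n$, $C_n$ or $D_n$. Then $G$ does not possess the $R_\infty$-property; that is, there exists an automorphism $\psi$ of the group $G$ with $R(\psi)<\infty$.
   Context: For a group $G$ and an automorphism $\varphi$ of $G$, elements $x,y\in G$ are called $\varphi$-conjugated if there is $z\in G$ with $x=zy\varphi(z)^{-1}$. This is an equivalence relation; its classes are the $\varphi$-conjugacy classes, and the number of classes is the Reidemeister number $R(\varphi)\in\{1,2,\dots\}\cup\{\infty\}$ (all infinite cardinals are denoted $\infty$). The group $G$ possesses the $R_\infty$-property if $R(\varphi)=\infty$ for every automorphism $\varphi$ of $G$ (as an abstract group). Chevalley groups are of normal (untwisted) type: given an irreducible reduced root system $\Phi$ and a field $F$, a Chevalley group of type $\Phi$ over $F$ is the group generated by the root elements $x_\alpha(t)$ ($\alpha\in\Phi$, $t\in F$) in the Chevalley construction attached to a faithful finite-dimensional representation of the complex simple Lie algebra with root system $\Phi$. The weight lattice of the representation may be any lattice between the root lattice and the full weight lattice, so the group need not be adjoint or simply connected. The types $B_n,C_n,D_n$ refer to the classical irreducible root systems of rank $n$ with these names, with the usual restrictions on $n$. *)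

(* Defs.v *)
From HB Require Import structures.
From mathcomp Require Import all_boot all_order all_algebra.
From mathcomp Require Import finmap all_classical all_reals.
From mathcomp Require Import complex.
From mathcomp Require mpoly.
Import -(notations) mpoly.

Set Implicit Arguments.
Unset Strict Implicit.
Unset Printing Implicit Defensive.

Import GRing.Theory.

Local Open Scope ring_scope.

Section Reidemeister.
Variable G : groupType.
Local Open Scope group_scope.
Local Open Scope classical_set_scope.

Record automorphism := Automorphism {
  aut_fun :> {multiplicative G -> G};
  aut_bij : bijective aut_fun }.

Definition twisted_conj (phi : automorphism) (x y : G) : Prop :=
  exists z : G, x = z * y * (phi z)^-1.

Definition twisted_classes (phi : automorphism) : set (set G) :=
  [set C | exists y : G, C = [set x | twisted_conj phi x y]].

Definition reidemeister (phi : automorphism) : \bar int :=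
  if `[< finite_set (twisted_classes phi) >]
  then ((#|` fset_set (twisted_classes phi)|)%fset%:Z)%:E else +oo%E.

Definition Rinfty_property : Prop :=
  forall phi : automorphism, reidemeister phi = +oo%E.

End Reidemeister.

Section TranscendenceDegree.
Variable F : fieldType.
Local Open Scope classical_set_scope.

(* [ratr] is the embedding of the rationals only if F has characteristic 0. *)
Definition alg_indep (B : set F) : Prop :=
  forall (m : nat) (b : 'I_m -> F), injective b -> (forall i, B (b i)) ->
  forall p : mpoly m rat, mmap (ratr : rat -> F) b p = 0 -> p = 0.

Definition transcendence_basis (B : set F) : Prop :=
  alg_indep B /\ (forall C : set F, B `<=` C -> alg_indep C -> C = B).

Definition infinite_trdeg : Prop :=
  exists2 B : set F, transcendence_basis B & infinite_set B.

End TranscendenceDegree.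

Section GeneralLinear.
Variables (F : fieldType) (N : nat).

Record GL := MkGL { GLmx :> 'M[F]_N; GLmx_unit : GLmx \in unitmx }.

HB.instance Definition _ := [isSub for GLmx].
HB.instance Definition _ := [Choice of GL by <:].

Definition GL_one : GL := MkGL (unitmx1 F N).
Definition GL_mul (A B : GL) : GL :=
  MkGL (etrans (unitmx_mul A B)
    (introT andP (conj (GLmx_unit A) (GLmx_unit B)))).
Definition GL_inv (A : GL) : GL :=
  MkGL (etrans (unitmx_inv A) (GLmx_unit A)).

Fact GL_mulA : associative GL_mul.
Proof. by move=> A B C; apply/val_inj/mulmxA. Qed.
Fact GL_mul1 : left_id GL_one GL_mul.
Proof. by move=> A; apply/val_inj/mul1mx. Qed.
Fact GL_mulr1 : right_id GL_one GL_mul.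
Proof. by move=> A; apply/val_inj/mulmx1. Qed.
Fact GL_mulV : left_inverse GL_one GL_inv GL_mul.
Proof. by move=> A; apply/val_inj/mulVmx/GLmx_unit. Qed.
Fact GL_mulrV : right_inverse GL_one GL_inv GL_mul.
Proof. by move=> A; apply/val_inj/mulmxV/GLmx_unit. Qed.

HB.instance Definition _ :=
  isGroup.Build GL GL_mulA GL_mul1 GL_mulr1 GL_mulV GL_mulrV.

End GeneralLinear.

Section GeneratedSubgroup.
Variables (G : groupType) (S : G -> Prop).

Definition generated : {pred G} := fun x =>
  `[< forall H : {pred G}, group_closed H -> (forall y, S y -> y \in H) ->
      x \in H >].

Fact generated_group_closed : group_closed generated.
Proof.
split=> [|x y /asboolP Hx /asboolP Hy]; apply/asboolP=> H cH sSH.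
  by case: cH.
by case: (cH) => _; apply; [apply: Hx | apply: Hy].
Qed.

Record subgroup_gen := SubgroupGen {
  sg_val :> G; sg_valP : sg_val \in generated }.

HB.instance Definition _ := [isSub for sg_val].
HB.instance Definition _ := [Choice of subgroup_gen by <:].
HB.instance Definition _ := SubChoice_isSubGroup.Build
  G generated subgroup_gen generated_group_closed.

End GeneratedSubgroup.

Section LieAlgebras.
Variable K : fieldType.

Record lieAlgebra := LieAlgebra {
  lie_space :> vectType K;
  lie_br : lie_space -> lie_space -> lie_space;
  lie_br_linearl : forall y, linear (fun x => lie_br x y);
  lie_br_linearr : forall x, linear (fun y => lie_br x y);
  lie_br_alt : forall x, lie_br x x = 0;
  lie_br_jacobi : forall x y z,
    lie_br x (lie_br y z) + lie_br y (lie_br z x) + lie_br z (lie_br x y)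
    = 0 }.

Variable L : lieAlgebra.
Local Notation "[[ x , y ]]" := (lie_br x y) (at level 0, x, y at level 99).

Definition lie_ideal (I : {vspace L}) : Prop :=
  forall x y, y \in I -> [[x, y]] \in I.

Definition lie_simple : Prop :=
  (exists x y : L, [[x, y]] != 0) /\
  (forall I : {vspace L}, lie_ideal I -> I = 0%VS \/ I = fullv).

Definition lie_subalgebra (H : {vspace L}) : Prop :=
  {in H &, forall x y, [[x, y]] \in H}.

Definition lie_nilpotent (H : {vspace L}) : Prop :=
  exists k : nat, forall (s : k.-tuple L) (y : L),
    (forall x, x \in s -> x \in H) -> y \in H ->
    foldr (@lie_br L) y s = 0.

(* Nilpotent and self-normalizing. *)
Definition cartan_subalgebra (H : {vspace L}) : Prop :=
  [/\ lie_subalgebra H, lie_nilpotent H &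
    forall x : L, {in H, forall h, [[x, h]] \in H} -> x \in H].

Section Roots.
Variable n : nat.

Definition dot (a b : 'rV[K]_n) : K := \sum_(i < n) a 0 i * b 0 i.

(* A linear isomorphism tau of K^n onto a Cartan subalgebra H identifies the
   dual of H with K^n: the row a stands for the functional sending tau c to
   [dot a c]. *)
Variable tau : 'Hom('rV[K]_n, L).

Definition in_root_space (a : 'rV[K]_n) (x : L) : Prop :=
  forall c : 'rV[K]_n, [[tau c, x]] = dot a c *: x.

Definition is_root (a : 'rV[K]_n) : Prop :=
  a != 0 /\ exists2 x : L, x != 0 & in_root_space a x.

Variable Phi : pred 'rV[int]_n.

(* The roots of L relative to the Cartan subalgebra tau (K^n) are exactly the
   vectors of Phi; a linear isomorphism matching two root systems preserves
   Cartan integers, so no separate condition on them is needed. *)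
Definition has_root_system : Prop :=
  [/\ lker tau = 0%VS, cartan_subalgebra (limg tau) &
    forall a : 'rV[K]_n,
      is_root a <-> exists2 v, Phi v & a = map_mx intr v].

(* The element h_v of H with w(h_v) = 2 (w, v) / (v, v) for every w. *)
Definition coroot (v : 'rV[int]_n) : L :=
  let a : 'rV[K]_n := map_mx intr v in tau ((2 / dot a a) *: a).

(* Chevalley's conditions on root vectors; together with the simple coroots,
   such a family is a Chevalley basis of L. *)
Definition chevalley_root_vectors (X : 'rV[int]_n -> L) : Prop :=
  [/\ forall v, Phi v -> in_root_space (map_mx intr v) (X v),
      forall v, Phi v -> [[X v, X (- v)]] = coroot v &
      forall v w, Phi v -> Phi w -> Phi (v + w) ->
        exists2 c : K, [[X v, X w]] = c *: X (v + w) &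
                       [[X (- v), X (- w)]] = - c *: X (- (v + w))].

End Roots.

Definition faithful_rep (N : nat) (rho : 'Hom(L, 'M[K]_N)) : Prop :=
  (forall x y : L, rho [[x, y]] = rho x *m rho y - rho y *m rho x) /\
  lker rho = 0%VS.

End LieAlgebras.

(* The data of the Chevalley construction over the complex numbers: a simple
   Lie algebra with root system Phi, a Chevalley basis, and a faithful
   representation on C^N in coordinates chosen so that the admissible lattice
   (stable under all rho(x_v)^k / k!) is Z^N.  The integer matrix of
   rho(x_v)^k / k! is [cd_divpow v k]. *)
Record chevalley_datum (R : realType) (n : nat) (Phi : pred 'rV[int]_n) :=
  ChevalleyDatum {
    cd_lie : lieAlgebra (complex R);
    cd_simple : lie_simple cd_lie;
    cd_cartan : 'Hom('rV[complex R]_n, cd_lie);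
    cd_roots : has_root_system cd_cartan Phi;
    cd_rootvec : 'rV[int]_n -> cd_lie;
    cd_chevalley : chevalley_root_vectors cd_cartan Phi cd_rootvec;
    cd_dim : nat;
    cd_rep : 'Hom(cd_lie, 'M[complex R]_cd_dim);
    cd_faithful : faithful_rep cd_rep;
    cd_divpow : 'rV[int]_n -> nat -> 'M[int]_cd_dim;
    cd_admissible : forall v k, Phi v ->
      map_mx intr (cd_divpow v k) =
      (k`!%:R : complex R)^-1 *: (cd_rep (cd_rootvec v)) ^+ k }.

Section ChevalleyGroup.
Variables (R : realType) (n : nat) (Phi : pred 'rV[int]_n).
Variables (D : chevalley_datum R Phi) (F : fieldType).
Local Notation N := (cd_dim D).

(* exp (t x_v), acting on Z^N tensored with F: rho(x_v) is a nilpotent N x N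
   matrix, so its powers of exponent at least N vanish. *)
Definition root_element (v : 'rV[int]_n) (t : F) : 'M[F]_N :=
  \sum_(k < N) t ^+ k *: map_mx intr (cd_divpow D v k).

Definition chevalley_generator (g : GL F N) : Prop :=
  exists2 v, Phi v & exists t : F, GLmx g = root_element v t.

Definition chevalley_group : groupType := subgroup_gen chevalley_generator.

End ChevalleyGroup.

Variant BCD_type := TypeB | TypeC | TypeD.

Section RootSystems.
Variable n : nat.
Local Notation e i := (delta_mx 0 i : 'rV[int]_n).

(* +- e_i +- e_j for i <> j *)
Definition two_coord_root (v : 'rV[int]_n) : bool :=
  [exists i, exists j, exists s : bool, exists t : bool,
    (i != j) && (v == (-1) ^+ s *: e i + (-1) ^+ t *: e j)].

(* +- m e_i *)
Definition one_coord_root (m : int) (v : 'rV[int]_n) : bool :=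
  [exists i, exists s : bool, v == ((-1) ^+ s * m) *: e i].

Definition BCD_roots (ty : BCD_type) : pred 'rV[int]_n :=
  match ty with
  | TypeB => fun v => two_coord_root v || one_coord_root 1 v
  | TypeC => fun v => two_coord_root v || one_coord_root 2 v
  | TypeD => two_coord_root
  end.

End RootSystems.

(* Below these ranks the systems are not irreducible or repeat another type
   (B_1 = C_1 = A_1, C_2 = B_2, D_3 = A_3). *)
Definition BCD_min_rank (ty : BCD_type) : nat :=
  match ty with TypeB => 2 | TypeC => 3 | TypeD => 4 end.

(* Main.v *)
Require Import Defs.
From HB Require Import structures.
From mathcomp Require Import all_boot all_order all_algebra.
From mathcomp Require Import all_classical all_reals.
From mathcomp Require Import ring complex.
From mathcomp Require mpoly.
Import -(notations) mpoly.

(** The root elements exp (t x_v) have integral coefficients, so an automorphism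
    [s] of the field F acts on the Chevalley group G entry by entry. It is
    enough to find [s] for which every g in G has the form z s(z)^-1 with z in
    G: all of G is then a single twisted conjugacy class. Equivalently, every
    equation s(z) = g z must have a solution z in G, an analogue of Lang's
    theorem for a sufficiently generic [s] in place of a Frobenius map.

    Such an [s] is built along a tower. Since F has infinite transcendence
    degree, a cardinality argument ([seq_embedding]) writes F as the union of
    an increasing sequence of algebraically closed subfields K_i such that
    K_(i+1) contains elements t_(g,j), for all matrices g and all integers j,
    that are independent over K_i ([generic_tower]). Fix a word v_1 ... v_m of
    roots, and let z_g be the product of the root elements exp (t_(g,j) x_(v_j)).
    For a suitable word this is a generic point of G: a polynomial that vanishes
    on all products of root elements along the word vanishes on G
    ([dominant_word], a dimension argument). Consequently a polynomial relation
    over K_i between the entries of the z_g holds for every family of elements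
    of G ([gen_family_vanish]), in particular for the family g z_g. So an
    automorphism of K_i extends to the field generated by the z_g by sending
    z_g to g z_g for each g in G with entries in K_i ([extend_step]), and from
    there to K_(i+1) because F is algebraically closed ([extend_automorphism]).
    In the limit all equations s(z) = g z are solved ([generic_automorphism]).

    Partial automorphisms of F are handled through their graphs, subfields of
    the ring F * F, for which Zorn's lemma and the passage to generated
    subfields are straightforward.

    The products of root elements form a group because exp ((s + t) x_v) =
    exp (s x_v) exp (t x_v). This identity rests on the nilpotency of rho(x_v),
    which follows from [h, x_v] = d x_v with d nonzero: the powers of rho(x_v)
    are eigenvectors of ad (rho(h)) for the distinct eigenvalues k d
    ([commutator_nilpotent]). *)

Set Implicit Arguments.
Unset Strict Implicit.
Unset Printing Implicit Defensive.

Import Order.TTheory GRing.Theory Num.Theory.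

Local Open Scope ring_scope.
Local Open Scope classical_set_scope.

(** * Graphs of partial field isomorphisms *)

Section PartialIso.
Variable F : fieldType.

(** A subring of [F * F] that meets each axis only at the origin is the graph of
    an isomorphism between two subrings of [F]. Working with graphs treats the
    two sides symmetrically and makes unions of chains immediate. *)
Definition iso_ring (G : set (F * F)) : Prop :=
  [/\ G 1, forall p q, G p -> G q -> G (p - q),
      forall p q, G p -> G q -> G (p * q) &
      forall p, G p -> (p.1 == 0) = (p.2 == 0)].

Definition iso_field (G : set (F * F)) : Prop :=
  iso_ring G /\ forall p, G p -> G (p.1^-1, p.2^-1).

(** The common abstract field of which the domain and the codomain of the
    isomorphism are two copies, through [pleft] and [pright]: one polynomial over
    it stands for a polynomial and its conjugate. *)
Record graph_field (G : set (F * F)) (isoG : iso_field G) :=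
  GraphField { graph_val : F * F; graph_valP : graph_val \in G }.

Section Sub.
Variables (G : set (F * F)) (isoG : iso_field G).
Local Notation E := (graph_field isoG).

HB.instance Definition _ := [isSub for @graph_val G isoG].
HB.instance Definition _ := [Choice of E by <:].

Fact graph_subring : subring_closed (fun x => x \in G).
Proof.
have [[G1 GB GM _] _] := isoG; split.
- exact/mem_set.
- by move=> p q /set_mem Gp /set_mem Gq; apply/mem_set/GB.
- by move=> p q /set_mem Gp /set_mem Gq; apply/mem_set/GM.
Qed.

HB.instance Definition _ := GRing.SubChoice_isSubComNzRing.Build
  (F * F)%type _ E graph_subring.

Fact graph_inv_subproof (e : E) : ((val e).1^-1, (val e).2^-1) \in G.
Proof. by have [_ GV] := isoG; apply/mem_set/GV/set_mem/valP. Qed.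

Definition graph_inv (e : E) : E := GraphField isoG (graph_inv_subproof e).

Fact graph_eq0 (e : E) : (e == 0) = ((val e).1 == 0).
Proof.
have [[_ _ _ /(_ _ (set_mem (valP e))) e12] _] := isoG.
rewrite -(inj_eq val_inj) rmorph0 -pair_eqE /= /pair_eq /=.
by rewrite -e12 andbb.
Qed.

Fact graph_mulVf (e : E) : e != 0 -> graph_inv e * e = 1.
Proof.
move=> e0; apply: val_inj; rewrite rmorphM rmorph1 /=.
have [[_ _ _ /(_ _ (set_mem (valP e))) e12] _] := isoG.
rewrite graph_eq0 in e0; have := e0; rewrite e12 => e0'.
by congr pair; rewrite /= mulVf.
Qed.

Fact graph_invr0 : graph_inv 0 = 0.
Proof. by apply: val_inj; rewrite rmorph0 /= !invr0. Qed.

HB.instance Definition _ := GRing.ComNzRing_isField.Build E graph_mulVf graph_invr0.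

Definition pleft (e : E) : F := (val e).1.
Definition pright (e : E) : F := (val e).2.

Fact pleft_zmod : {morph pleft : x y / x - y}. Proof. by []. Qed.
Fact pright_zmod : {morph pright : x y / x - y}. Proof. by []. Qed.
Fact pleft_monoid : monoid_morphism pleft. Proof. by []. Qed.
Fact pright_monoid : monoid_morphism pright. Proof. by []. Qed.
HB.instance Definition _ := GRing.isZmodMorphism.Build E F pleft pleft_zmod.
HB.instance Definition _ := GRing.isZmodMorphism.Build E F pright pright_zmod.
HB.instance Definition _ := GRing.isMonoidMorphism.Build E F pleft pleft_monoid.
HB.instance Definition _ := GRing.isMonoidMorphism.Build E F pright pright_monoid.

Lemma graph_in (e : E) : G (pleft e, pright e).
Proof. by rewrite -surjective_pairing; apply/set_mem/valP. Qed.

Lemma graph_ex p : G p -> exists e : E, pleft e = p.1 /\ pright e = p.2.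
Proof. by move=> Gp; exists (GraphField isoG (mem_set Gp)). Qed.

End Sub.
End PartialIso.
Arguments pleft {F G isoG} e.
Arguments pright {F G isoG} e.

(** * Chains and relative algebraic closure *)

(** [Zorn_bigcup] applied to the sets [X] such that [A0 `|` X] satisfies [P]: the
    empty chain, which it does not exclude, is taken care of by [P A0]. *)
Lemma Zorn_above T (P : set (set T)) (A0 : set T) :
    P A0 ->
    (forall C : set (set T), C !=set0 -> C `<=` P -> total_on C subset ->
      P (\bigcup_(X in C) X)) ->
  exists A, [/\ A0 `<=` A, P A & forall B, A `<=` B -> P B -> B `<=` A].
Proof.
move=> PA0 Pchain.
have [C CP totC|A [PA maxA]] := @Zorn_bigcup T [set X | P (A0 `|` X)].
  have [C0|/set0P[X0 CX0]] := eqVneq C set0.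
    by rewrite /= C0 bigcup_set0 setU0.
  rewrite /=.
  have -> : A0 `|` \bigcup_(X in C) X =
            \bigcup_(Y in [set A0 `|` X | X in C]) Y.
    rewrite bigcup_image eqEsubset; split=> x.
      by case=> [A0x|[X CX Xx]]; [exists X0 => //; left|exists X => //; right].
    by case=> X CX [A0x|Xx]; [left|right; exists X].
  apply: Pchain; first by exists (A0 `|` X0), X0.
    by move=> _ [X CX <-]; apply: CP.
  move=> _ _ [X CX <-] [Y CY <-].
  by have [XY|YX] := totC _ _ CX CY; [left|right]; apply: setUS.
exists (A0 `|` A); split=> [|//|B AB PB]; first exact: subsetUl.
have AB' : A `<=` B by apply: subset_trans AB; apply: subsetUr.
have A0B : A0 `<=` B by apply: subset_trans AB; apply: subsetUl.
apply: contrapT => nBA; apply: (maxA B); last by rewrite /= setUidr.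
by split=> // BA; apply: nBA; apply: subset_trans BA (@subsetUr _ _ _).
Qed.

Lemma chain_pair T (C : set (set T)) p q : total_on C subset ->
    (\bigcup_(X in C) X) p -> (\bigcup_(X in C) X) q ->
  exists X, [/\ C X, X p & X q].
Proof.
move=> totC [X CX Xp] [Y CY Yq]; have [XY|YX] := totC _ _ CX CY.
  by exists Y; split => //; apply: XY.
by exists X; split => //; apply: YX.
Qed.

Lemma tower_le T (K : nat -> set T) i j :
  (forall k, K k `<=` K k.+1) -> (i <= j)%N -> K i `<=` K j.
Proof.
by move=> KS /subnK<-; elim: (j - i)%N => // n IH x /IH /KS.
Qed.

Section RelClosed.
Variable F : fieldType.
Implicit Types (K A : set F) (G : set (F * F)).

(** These subsets are subfields (an inverse of [x] is a root of [x *: 'X - 1]), and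
    the conditions pass to intersections, which is what [aclosure] relies on. *)
Definition rel_closed K : Prop :=
  [/\ K 1, forall x y, K x -> K y -> K (x - y),
      forall x y, K x -> K y -> K (x * y) &
      forall (q : {poly F}) x, q != 0 -> (forall i, K q`_i) -> root q x -> K x].

Section RelClosedTheory.
Variables (K : set F) (Kr : rel_closed K).

Lemma rel_closed1 : K 1. Proof. by case: Kr. Qed.
Lemma rel_closedB x y : K x -> K y -> K (x - y).
Proof. by case: Kr => _ + _ _; apply. Qed.
Lemma rel_closedM x y : K x -> K y -> K (x * y).
Proof. by case: Kr => _ _ + _; apply. Qed.
Lemma rel_closed_root (q : {poly F}) x :
  q != 0 -> (forall i, K q`_i) -> root q x -> K x.
Proof. by case: Kr => _ _ _; apply. Qed.
Lemma rel_closed0 : K 0.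
Proof. by rewrite -(subrr 1); apply: rel_closedB rel_closed1 rel_closed1. Qed.
Lemma rel_closedN x : K x -> K (- x).
Proof. by rewrite -(sub0r x); apply: rel_closedB rel_closed0. Qed.
Lemma rel_closedD x y : K x -> K y -> K (x + y).
Proof. by move=> Kx Ky; rewrite -(opprK y); apply/rel_closedB/rel_closedN. Qed.
Lemma rel_closed_sum I r (P : pred I) f :
  (forall i, P i -> K (f i)) -> K (\sum_(i <- r | P i) f i).
Proof. by move=> Kf; elim/big_ind: _ => //; [apply: rel_closed0|apply: rel_closedD]. Qed.
Lemma rel_closedX x n : K x -> K (x ^+ n).
Proof.
move=> Kx; elim: n => [|n IH]; first exact: rel_closed1.
by rewrite exprS; apply: rel_closedM.
Qed.
Lemma rel_closed_horner (p : {poly F}) x : (forall i, K p`_i) -> K x -> K p.[x].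
Proof.
move=> Kp Kx; rewrite horner_coef; apply: rel_closed_sum => i _.
by apply: rel_closedM => //; apply: rel_closedX.
Qed.
Lemma rel_closedV x : K x -> K x^-1.
Proof.
move=> Kx; have [->|x0] := eqVneq x 0; first by rewrite invr0; apply: rel_closed0.
apply: (@rel_closed_root (x *: 'X - 1)).
- apply/eqP => /(congr1 (fun p : {poly F} => p`_1)).
  by rewrite coefB coefZ coefX coef1 coef0 mulr1 subr0 => /eqP; apply/negP.
- move=> i; rewrite coefB coefZ coefX coef1; apply: rel_closedB.
    by case: eqP; rewrite ?mulr1 ?mulr0 // => _; apply: rel_closed0.
  by case: eqP => _; [apply: rel_closed1|apply: rel_closed0].
by rewrite rootE !hornerE mulfV // subrr.
Qed.
End RelClosedTheory.

Lemma rel_closed_int (K : set F) (a : int) : rel_closed K -> K a%:~R.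
Proof.
move=> Kr; have Kn n : K n%:R.
  elim: n => [|n IH]; first exact: rel_closed0.
  by rewrite mulrS; apply: rel_closedD (rel_closed1 Kr) IH.
by case: a => n; rewrite ?NegzE ?mulrNz -pmulrn; [|apply: rel_closedN].
Qed.

Lemma rel_closedT : rel_closed setT. Proof. by []. Qed.

Definition aclosure A : set F :=
  [set x | forall K, rel_closed K -> A `<=` K -> K x].

Lemma sub_aclosure A : A `<=` aclosure A. Proof. by move=> x Ax K _; apply. Qed.

Lemma aclosure_min A K : rel_closed K -> A `<=` K -> aclosure A `<=` K.
Proof. by move=> Kr AK x; apply. Qed.

Lemma aclosure_closed A : rel_closed (aclosure A).
Proof.
split.
- by move=> K Kr _; apply: rel_closed1.
- by move=> x y Ax Ay K Kr AK; apply: (rel_closedB Kr); [apply: Ax|apply: Ay].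
- by move=> x y Ax Ay K Kr AK; apply: (rel_closedM Kr); [apply: Ax|apply: Ay].
move=> q x q0 Aq qx K Kr AK; apply: (rel_closed_root Kr q0 _ qx) => i.
exact: Aq.
Qed.

Lemma aclosure_sub A B : A `<=` B -> aclosure A `<=` aclosure B.
Proof.
move=> AB; apply: aclosure_min (aclosure_closed B) _.
exact: subset_trans AB (@sub_aclosure B).
Qed.

(** * Extending isomorphisms and algebraic closures *)

Lemma iso_ring_neq0 G p : iso_ring G -> G p -> p.1 != 0 -> p.2 != 0.
Proof. by case=> _ _ _ G0 /G0 <-. Qed.

Definition graph_frac G : set (F * F) :=
  [set p | exists a b, [/\ G a, G b, b.1 != 0 & p = (a.1 / b.1, a.2 / b.2)]].

Lemma sub_graph_frac G : iso_ring G -> G `<=` graph_frac G.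
Proof.
case=> G1 _ _ _ p Gp; exists p, 1; split => //=; first exact: oner_neq0.
by rewrite !divr1 -surjective_pairing.
Qed.

Lemma graph_frac_iso_field G : iso_ring G -> iso_field (graph_frac G).
Proof.
move=> isoG; have [G1 GB GM G0] := isoG; split; last first.
  move=> _ [a [b [Ga Gb b0 ->]]] /=.
  have [a0|a0] := eqVneq a.1 0.
    have /eqP a0' : a.2 == 0 by rewrite -G0 ?a0.
    rewrite a0 a0' !mul0r !invr0; exists 0, 1; split=> //=; first last.
    - by rewrite !mul0r.
    - exact: oner_neq0.
    - by rewrite -(subrr 1); apply: GB.
  by exists b, a; split=> //; rewrite !invf_div.
split.
- exact: sub_graph_frac.
- move=> _ _ [a [b [Ga Gb b0 ->]]] [c [d [Gc Gd d0 ->]]].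
  have b0' := iso_ring_neq0 isoG Gb b0.
  have d0' := iso_ring_neq0 isoG Gd d0.
  exists (a * d - c * b), (b * d); split; [|exact: GM|exact: mulf_neq0|].
    by apply: GB; apply: GM.
  by congr pair; rewrite /= -(mulNr (_ c) (_^-1)) addf_div // mulNr.
- move=> _ _ [a [b [Ga Gb b0 ->]]] [c [d [Gc Gd d0 ->]]].
  exists (a * c), (b * d); split; [exact: GM|exact: GM|exact: mulf_neq0|].
  by congr pair; rewrite mulf_div.
move=> _ [a [b [Ga Gb b0 ->]]] /=; have b0' := iso_ring_neq0 isoG Gb b0.
by rewrite !mulf_eq0 !invr_eq0 (negPf b0) (negPf b0') !orbF G0.
Qed.

Definition gdom G : set F := [set x | exists y, G (x, y)].
Definition gcod G : set F := [set y | exists x, G (x, y)].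
Definition gswap G : set (F * F) := [set p | G (p.2, p.1)].

Lemma gswap_iso_field G : iso_field G -> iso_field (gswap G).
Proof.
case=> -[G1 GB GM G0] GV; split; last by move=> p /= Gp; apply: (GV _ Gp).
split=> [//|p q Gp Gq|p q Gp Gq|p Gp].
- exact: (GB _ _ Gp Gq).
- exact: (GM _ _ Gp Gq).
- by rewrite (G0 _ Gp).
Qed.

Lemma iso_field_chain (C : set (set (F * F))) :
  C !=set0 -> (forall G, C G -> iso_field G) -> total_on C subset ->
  iso_field (\bigcup_(X in C) X).
Proof.
move=> [G CG] isoC totC.
have two p q := @chain_pair _ C p q totC.
split; last by move=> p [X CX Xp]; exists X => //; apply: (isoC X CX).2.
split.
- by exists G => //; case: (isoC _ CG) => -[].
- move=> p q /two h /h [X [CX Xp Xq]]; exists X => //.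
  by case: (isoC _ CX) => -[_ XB _ _] _; apply: XB.
- move=> p q /two h /h [X [CX Xp Xq]]; exists X => //.
  by case: (isoC _ CX) => -[_ _ XM _] _; apply: XM.
by move=> p [X CX Xp]; case: (isoC _ CX) => -[_ _ _ X0] _; apply: X0.
Qed.

Section Adjoin.
Variables (G : set (F * F)) (isoG : iso_field G) (x y : F).
Local Notation E := (graph_field isoG).

Definition polypair (p : {poly E}) : F * F :=
  ((map_poly pleft p).[x], (map_poly pright p).[y]).

Definition adjoin : set (F * F) := graph_frac [set polypair p | p in setT].

Hypothesis xy : forall p : {poly E},
  root (map_poly pleft p) x = root (map_poly pright p) y.

Lemma adjoin_iso_ring : iso_ring [set polypair p | p in setT].
Proof.
split.
- by exists 1 => //; rewrite /polypair !rmorph1 !hornerE.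
- move=> _ _ [p _ <-] [q _ <-]; exists (p - q) => //.
  by rewrite /polypair !rmorphB !hornerE.
- move=> _ _ [p _ <-] [q _ <-]; exists (p * q) => //.
  by rewrite /polypair !rmorphM !hornerE.
by move=> _ [p _ <-]; apply: xy.
Qed.

Lemma adjoin_iso_field : iso_field adjoin.
Proof. exact: graph_frac_iso_field adjoin_iso_ring. Qed.

Lemma adjoin_sub : G `<=` adjoin.
Proof.
move=> p /(graph_ex isoG)[e [e1 e2]]; apply: (sub_graph_frac adjoin_iso_ring).
exists e%:P => //; rewrite /polypair !map_polyC !hornerE /= e1 e2.
by rewrite -surjective_pairing.
Qed.

Lemma adjoin_xy : adjoin (x, y).
Proof.
apply: (sub_graph_frac adjoin_iso_ring); exists 'X => //.
by rewrite /polypair !map_polyX !hornerX.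
Qed.

Lemma adjoin_le K : rel_closed K -> G `<=` K `*` K -> K x -> K y ->
  adjoin `<=` K `*` K.
Proof.
move=> Kr GK Kx Ky.
have K1 (p : {poly E}) : K (map_poly pleft p).[x].
  apply: rel_closed_horner => // i; rewrite coef_map.
  by case: (GK _ (graph_in p`_i)).
have K2 (p : {poly E}) : K (map_poly pright p).[y].
  apply: rel_closed_horner => // i; rewrite coef_map.
  by case: (GK _ (graph_in p`_i)).
move=> _ [_ [_ [[a _ <-] [b _ <-] _ ->]]].
by split; rewrite /=; apply: (rel_closedM Kr) => //; apply: (rel_closedV Kr).
Qed.

End Adjoin.

Lemma poly_lift_left G (isoG : iso_field G) (q : {poly F}) :
  (forall i, gdom G q`_i) ->
  exists p : {poly graph_field isoG}, map_poly pleft p = q.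
Proof.
move=> qG; have /choice[f fq] i : exists e : graph_field isoG, pleft e = q`_i.
  by have [y /(graph_ex isoG)[e [e1 _]]] := qG i; exists e.
exists (\poly_(i < size q) f i); apply/polyP => i; rewrite coef_map coef_poly.
case: ltnP => [_|qi] /=; first exact: fq.
by rewrite rmorph0 nth_default.
Qed.

Lemma poly_lift_right G (isoG : iso_field G) (q : {poly F}) :
  (forall i, gcod G q`_i) ->
  exists p : {poly graph_field isoG}, map_poly pright p = q.
Proof.
move=> qG; have /choice[f fq] i : exists e : graph_field isoG, pright e = q`_i.
  by have [y /(graph_ex isoG)[e [_ e2]]] := qG i; exists e.
exists (\poly_(i < size q) f i); apply/polyP => i; rewrite coef_map coef_poly.
case: ltnP => [_|qi] /=; first exact: fq.
by rewrite rmorph0 nth_default.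
Qed.

End RelClosed.

Section AdjoinDom.
Variables (F : fieldType) (G : set (F * F)) (isoG : iso_field G) (x y : F).
Hypothesis xy : forall p : {poly graph_field isoG},
  root (map_poly pleft p) x = root (map_poly pright p) y.

Definition fracs (L : set F) (z : F) : set F :=
  [set w | exists p r : {poly F}, [/\ forall i, L p`_i, forall i, L r`_i,
    r.[z] != 0 & w = p.[z] / r.[z]]].

Lemma gdom_adjoin : gdom (adjoin isoG x y) = fracs (gdom G) x.
Proof.
rewrite eqEsubset; split=> w.
  move=> [w' [_ [_ [[a _ <-] [b _ <-] b0 [-> _]]]]].
  exists (map_poly pleft a), (map_poly pleft b); split=> // i; rewrite coef_map.
    by exists (pright a`_i); apply: graph_in.
  by exists (pright b`_i); apply: graph_in.
move=> [p [r [/(poly_lift_left isoG)[p' <-] /(poly_lift_left isoG)[r' <-] r0 ->]]].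
exists ((polypair x y p').2 / (polypair x y r').2).
by exists (polypair x y p'), (polypair x y r').
Qed.

Lemma gcod_adjoin : gcod (adjoin isoG x y) = fracs (gcod G) y.
Proof.
rewrite eqEsubset; split=> w.
  move=> [w' [_ [_ [[a _ <-] [b _ <-] b0 [_ ->]]]]].
  exists (map_poly pright a), (map_poly pright b); split=> //; last first.
    by move: b0; rewrite /= -!rootE xy.
    by move=> i; rewrite coef_map; exists (pleft b`_i); apply: graph_in.
  by move=> i; rewrite coef_map; exists (pleft a`_i); apply: graph_in.
move=> [p [r [/(poly_lift_right isoG)[p' <-] /(poly_lift_right isoG)[r' <-] r0 ->]]].
exists ((polypair x y p').1 / (polypair x y r').1).
exists (polypair x y p'), (polypair x y r').
by split=> //; move: r0; rewrite /= -!rootE xy.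
Qed.

End AdjoinDom.

(** Let [q] have minimal degree among the polynomials vanishing at [x], and let
    [y] be a root of its conjugate. A polynomial vanishing at [x] is a multiple of
    [q]. Conversely, if the conjugate of [p] vanishes at [y], so does that of
    [g := gcdp p q], which is thus not constant; as [q] vanishes at [x], so does
    [g] or its cofactor, and the cofactor is too short to do so; finally [g]
    divides [p]. *)
Lemma conjugate_root (F : closedFieldType) G (isoG : iso_field G)
    (q : {poly graph_field isoG}) (x : F) :
    q != 0 -> root (map_poly pleft q) x ->
  exists y, forall p : {poly graph_field isoG},
    root (map_poly pleft p) x = root (map_poly pright p) y.
Proof.
move=> q0 qx.
have ex : exists n, `[< exists p : {poly graph_field isoG},
    [/\ p != 0, root (map_poly pleft p) x & size p = n] >].
  by exists (size q); apply/asboolP; exists q.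
case: (ex_minnP ex) => n /asboolP[{q0 qx}q [q0 qx <-]] minq.
have {}minq (p : {poly graph_field isoG}) :
    p != 0 -> root (map_poly pleft p) x -> (size q <= size p)%N.
  by move=> p0 px; apply: minq; apply/asboolP; exists p.
have sq : size q != 1.
  apply: contraL qx => /size_poly1P[c c0 ->].
  by rewrite map_polyC rootC fmorph_eq0.
have /closed_rootP[y qy] : size (map_poly pright q) != 1 by rewrite size_map_poly.
exists y => p; apply/idP/idP => [px|py].
  have [/modp_eq0P/dvdpP[r ->]|r0] := eqVneq (p %% q)%R 0.
    by rewrite rmorphM rootM qy orbT.
  have : (size q <= size (p %% q)%R)%N.
    apply: minq => //; rewrite (_ : (p %% q)%R = p - (p %/ q)%R * q).
      rewrite rmorphB rmorphM rootE !hornerE.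
      by rewrite (rootP px) (rootP qx) mulr0 subrr.
    by rewrite {2}(divp_eq p q) addrC addKr.
  by rewrite leqNgt ltn_modp q0.
have [[u v] /= uv] := Bezoutp p q; set g := gcdp p q in uv.
have gy : root (map_poly pright g) y.
  have /dvdpP[r ->] : (u * p + v * q)%R %| g by rewrite (eqp_dvdl _ uv).
  rewrite rmorphM rootM rmorphD !rmorphM /=; apply/orP; right.
  by rewrite rootE !hornerE (rootP py) (rootP qy) !mulr0 addr0.
have g0 : g != 0 by rewrite gcdp_eq0 negb_and q0 orbT.
have /dvdpP[h qh] : g %| q by apply: dvdp_gcdr.
have h0 : h != 0 by apply: contraNneq q0; rewrite qh => ->; rewrite mul0r.
move: qx; rewrite qh rmorphM rootM => /orP[hx|gx]; last first.
  have /dvdpP[r ->] : g %| p by apply: dvdp_gcdl.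
  by rewrite rmorphM rootM gx orbT.
have := minq _ h0 hx; rewrite qh size_mul // -subn1 leq_subLR addnC leq_add2r.
move=> sg; have /size_poly1P[c c0 gc] : size g == 1.
  by rewrite eqn_leq sg size_poly_gt0.
by move: gy; rewrite gc map_polyC rootC fmorph_eq0 (negPf c0).
Qed.

(** The elements algebraic over the domain form a subfield that contains the
    roots of its polynomials, by transitivity of integrality. *)
Lemma algebraic_aclosure (F : fieldType) G (isoG : iso_field G) (x : F) :
  aclosure (gdom G) x -> algebraicOver (@pleft F G isoG) x.
Proof.
move=> /(_ [set x | algebraicOver (@pleft F G isoG) x]); apply.
  split.
  - exact: algebraic1.
  - exact: algebraic_sub.
  - exact: algebraic_mul.
  move=> q {}x q0 qi qx; apply/(integral_algebraic pleft).
  apply: (integral_root q0 qx).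
  apply/integral_poly => i.
  by apply/integral_algebraic; apply: qi.
by move=> {}x [y /(graph_ex isoG)[e [/= <- _]]]; apply: algebraic_id.
Qed.

Section Extension.
Variables (F : closedFieldType) (K : set F).
Hypothesis Kr : rel_closed K.
Implicit Types G : set (F * F).

Lemma adjoin_root G (q : {poly F}) x :
    iso_field G -> G `<=` K `*` K -> q != 0 -> (forall i, gdom G q`_i) ->
    root q x ->
  exists G', [/\ iso_field G', G `<=` G', G' `<=` K `*` K & gdom G' x].
Proof.
move=> isoG GK + /(poly_lift_left isoG)[p qp] qx; rewrite -{q}qp in qx *.
rewrite map_poly_eq0 => p0; have [y xy] := conjugate_root p0 qx.
have Kx : K x.
  apply: (rel_closed_root Kr _ _ qx); first by rewrite map_poly_eq0.
  by move=> i; rewrite coef_map; case: (GK _ (graph_in p`_i)).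
have Ky : K y.
  apply: (@rel_closed_root _ _ Kr (map_poly pright p)); last by rewrite -xy.
    by rewrite map_poly_eq0.
  by move=> i; rewrite coef_map; case: (GK _ (graph_in p`_i)).
exists (adjoin isoG x y); split.
- exact: adjoin_iso_field.
- exact: adjoin_sub.
- exact: adjoin_le.
- by exists y; apply: adjoin_xy.
Qed.

(** A missing root could be adjoined, together with a conjugate. *)
Lemma maximal_gdom_closed G :
    iso_field G -> G `<=` K `*` K ->
    (forall G', G `<=` G' -> iso_field G' -> G' `<=` K `*` K -> G' `<=` G) ->
  rel_closed (gdom G).
Proof.
move=> isoG GK maxG; have [[G1 GB GM G0] GV] := isoG; split.
- by exists 1.
- by move=> x y [x' Gx] [y' Gy]; exists (x' - y'); apply: (GB _ _ Gx Gy).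
- by move=> x y [x' Gx] [y' Gy]; exists (x' * y'); apply: (GM _ _ Gx Gy).
move=> q x q0 qG qx.
have [G' [isoG' GG' G'K [y G'y]]] := adjoin_root isoG GK q0 qG qx.
by exists y; apply: maxG G'y.
Qed.

(** Pairs (x, x) with [x] transcendental over the domain are adjoined first, until
    [K] is algebraic over it; algebraic elements come next. Without the first
    stage a maximal graph might have domain [K] and a smaller codomain. *)
Lemma extend_automorphism G :
    iso_field G -> G `<=` K `*` K -> gdom G = gcod G ->
  exists G', [/\ iso_field G', G `<=` G', gdom G' = K & gcod G' = K].
Proof.
move=> isoG GK Gdc.
pose P1 := [set X : set (F * F) |
  [/\ iso_field X, X `<=` K `*` K & gdom X = gcod X]].
have [||G1 [GG1 [isoG1 G1K G1dc] maxG1]] := @Zorn_above _ P1 G; first by [].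
  move=> C C0 CP totC; split.
  - by apply: iso_field_chain => // X /CP[].
  - by move=> p [X /CP[_ + _]]; apply.
  rewrite eqEsubset; split=> x [y [X CX Xxy]].
    have : gdom X x by exists y.
    by case: (CP _ CX) => _ _ -> [z Xz]; exists z, X.
  have : gcod X x by exists y.
  by case: (CP _ CX) => _ _ <- [z Xz]; exists z, X.
(* Otherwise (x, x) could be adjoined, x and its conjugate x being both
   transcendental. *)
have KclG1 : K `<=` aclosure (gdom G1).
  move=> x Kx; apply: contrapT => nx.
  have xx (p : {poly graph_field isoG1}) :
      root (map_poly pleft p) x = root (map_poly pright p) x.
    have [->|p0] := eqVneq p 0; first by rewrite !rmorph0.
    transitivity false; last symmetry; apply/negP => px; apply: nx.
      apply: (rel_closed_root (aclosure_closed _) _ _ px).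
        by rewrite map_poly_eq0.
      move=> i; rewrite coef_map; apply: sub_aclosure.
      by exists (pright p`_i); apply: graph_in.
    apply: (rel_closed_root (aclosure_closed _) _ _ px).
      by rewrite map_poly_eq0.
    move=> i; rewrite coef_map; apply: sub_aclosure; rewrite G1dc.
    by exists (pleft p`_i); apply: graph_in.
  apply: nx; apply: sub_aclosure; exists x.
  apply: (maxG1 (adjoin isoG1 x x)) (adjoin_xy xx); first exact: adjoin_sub.
  split; first exact: adjoin_iso_field.
    exact: adjoin_le.
  by rewrite gdom_adjoin // gcod_adjoin // G1dc.
pose P2 := [set X : set (F * F) | iso_field X /\ X `<=` K `*` K].
have [||G2 [G12 [isoG2 G2K] maxG2]] := @Zorn_above _ P2 G1; first by [].
  move=> C C0 CP totC; split.
  - by apply: iso_field_chain => // X /CP[].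
  - by move=> p [X /CP[_ +]]; apply.
have domr : rel_closed (gdom G2).
  by apply: maximal_gdom_closed => // G' GG' isoG' G'K; apply: maxG2.
have codr : rel_closed (gcod G2).
  apply: (@maximal_gdom_closed (gswap G2)); first exact: gswap_iso_field.
    by move=> [x y] /G2K[].
  move=> G' GG' isoG' G'K [x y] G'xy.
  suff: gswap G' `<=` G2 by apply.
  apply: maxG2.
    by move=> [u v] Guv; apply: GG'.
  by split; [apply: gswap_iso_field|move=> [u v] /G'K[]].
exists G2; split => //; first exact: subset_trans G12.
- rewrite eqEsubset; split=> [x [y /G2K[]//]|].
  apply: subset_trans KclG1 _; apply: aclosure_min domr _ => x [y Gxy].
  by exists y; apply: G12.
rewrite eqEsubset; split=> [x [y /G2K[]//]|].
apply: subset_trans KclG1 _; apply: aclosure_min codr _; rewrite G1dc => x [y Gxy].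
by exists y; apply: G12.
Qed.

End Extension.

Section AlgebraicOverRing.
Variables (F : fieldType) (R : set F).
Hypotheses (R1 : R 1) (RB : forall x y, R x -> R y -> R (x - y))
  (RM : forall x y, R x -> R y -> R (x * y)).

Lemma common_denominator (c : nat -> F) n :
  (forall i, exists a b, [/\ R a, R b, b != 0 & c i = a / b]) ->
  exists d, [/\ R d, d != 0 & forall i, (i < n)%N -> R (d * c i)].
Proof.
move=> cR; elim: n => [|n [d [Rd d0 dc]]].
  by exists 1; split => //; apply: oner_neq0.
have [a [b [Ra Rb b0 cab]]] := cR n; exists (d * b); split.
- exact: RM.
- exact: mulf_neq0.
move=> i; rewrite ltnS leq_eqVlt => /predU1P[->|/dc Rdc].
  by rewrite cab -mulrA [b * _]mulrC divfK //; apply: RM.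
by rewrite mulrAC; apply: RM.
Qed.

(** Denominators are cleared from an equation over the field of fractions of [R],
    which is then divided by the highest possible power of the variable. *)
Lemma algebraic_over_ring x : aclosure R x -> x != 0 ->
  exists q : {poly F}, [/\ q`_0 != 0, forall i, R q`_i & root q x].
Proof.
move=> clRx x0; have R0 : R 0 by rewrite -(subrr 1); apply: RB.
pose D : set (F * F) := [set p | R p.1 /\ p.2 = p.1].
have isoD : iso_ring D.
  split=> [//|||[a a'] [/= Ra ->] //].
    by move=> [a a'] [b b'] [/= Ra ->] [/= Rb ->]; split=> //; apply: RB.
  by move=> [a a'] [b b'] [/= Ra ->] [/= Rb ->]; split=> //; apply: RM.
have isoD' := graph_frac_iso_field isoD.
have [|p p0 px] := @algebraic_aclosure _ _ isoD' x.
  apply: aclosure_sub clRx => a Ra; exists a.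
  by apply: (sub_graph_frac isoD).
have [|d [Rd d0 dp]] := @common_denominator
    (fun i => (map_poly pleft p)`_i) (size (map_poly pleft p)).
  move=> i; rewrite coef_map.
  have [a [b [[Ra _] [Rb _] b0 [pE _]]]] := graph_in p`_i.
  by exists a.1, b.1; split.
pose q := d *: map_poly pleft p.
have Rq i : R q`_i.
  rewrite coefZ; case: (ltnP i (size (map_poly pleft p))) => [/dp//|ip].
  by rewrite nth_default ?mulr0.
have q0 : q != 0 by rewrite scaler_eq0 negb_or d0 map_poly_eq0.
have qx : root q x by rewrite rootZ.
move: {2}(size q) (leqnn (size q)) => n.
elim: n q Rq q0 qx => [|n IH] q Rq q0 qx sq.
  by rewrite leqn0 size_poly_eq0 (negPf q0) in sq.
have [q00|q00] := eqVneq q`_0 0; last by exists q.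
have qE : q = \poly_(i < (size q).-1) q`_i.+1 * 'X.
  apply/polyP => -[|i]; rewrite coefMX //= coef_poly.
  case: ltnP => // iq; rewrite nth_default //.
  by rewrite -(leq_add2r 1) !addn1 in iq; apply: leq_trans (leqSpred _) iq.
set r := \poly_(_ < _) _ in qE.
apply: (IH r).
- by move=> i; rewrite coef_poly; case: ifP.
- by apply: contraNneq q0; rewrite qE => ->; rewrite mul0r.
- by move: qx; rewrite qE rootM rootX (negPf x0) orbF.
apply: leq_trans (size_poly _ _) _.
by rewrite -ltnS prednK // size_poly_gt0.
Qed.

End AlgebraicOverRing.

(** * Polynomial functions and generic points *)

Section PolyFun.
Variable F : fieldType.

(** Polynomials in the functions [A] with coefficients in [K], taken as functions:
    restriction to a subset, substitution and specialisation are then plain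
    evaluation and composition, whatever the number of variables. *)
Inductive polyfun (X : Type) (K : set F) (A : set (X -> F)) : (X -> F) -> Prop :=
| pf_const c : K c -> polyfun K A (fun=> c)
| pf_gen f : A f -> polyfun K A f
| pf_add f g : polyfun K A f -> polyfun K A g -> polyfun K A (fun x => f x + g x)
| pf_mul f g : polyfun K A f -> polyfun K A g -> polyfun K A (fun x => f x * g x).

Lemma pf_comp X Y (phi : Y -> X) (K K' : set F) A A' f :
  K `<=` K' -> (forall a, A a -> polyfun K' A' (fun y => a (phi y))) ->
  polyfun K A f -> polyfun K' A' (fun y => f (phi y)).
Proof.
move=> KK' AA'; elim=> [c /KK'|{}f /AA'|{}f g _ Hf _ Hg|{}f g _ Hf _ Hg] //.
- exact: pf_const.
- exact: pf_add.
- exact: pf_mul.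
Qed.

Lemma pf_sub X (K K' : set F) (A A' : set (X -> F)) f :
  K `<=` K' -> A `<=` A' -> polyfun K A f -> polyfun K' A' f.
Proof. by move=> KK' AA'; apply: (@pf_comp X X id) => // a /AA'; apply: pf_gen. Qed.

Lemma pf_eval X (K L : set F) (A : set (X -> F)) x f :
  rel_closed L -> K `<=` L -> (forall a, A a -> L (a x)) -> polyfun K A f -> L (f x).
Proof.
move=> Lr KL AL; elim=> [c /KL|{}f /AL|{}f g _ Hf _ Hg|{}f g _ Hf _ Hg] //.
  exact: rel_closedD.
exact: rel_closedM.
Qed.

Lemma pf_sum X (K : set F) (A : set (X -> F)) I (r : seq I) (P : pred I)
    (h : I -> X -> F) :
  K 0 -> (forall i, P i -> polyfun K A (h i)) ->
  polyfun K A (fun x => \sum_(i <- r | P i) h i x).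
Proof.
move=> K0 Ph; elim: r => [|i r IH].
  by under eq_fun do rewrite big_nil; apply: pf_const.
under eq_fun do rewrite big_cons.
by case: (boolP (P i)) => Pi //; apply: pf_add => //; apply: Ph.
Qed.

Lemma pf_exp X (K : set F) (A : set (X -> F)) f n :
  K 1 -> polyfun K A f -> polyfun K A (fun x => f x ^+ n).
Proof.
move=> K1 Pf; elim: n => [|n IH].
  by under eq_fun do rewrite expr0; apply: pf_const.
by under eq_fun do rewrite exprS; apply: pf_mul.
Qed.

Lemma pf_agree X (K : set F) (A : set (X -> F)) f x y :
  (forall a, A a -> a x = a y) -> polyfun K A f -> f x = f y.
Proof.
by move=> Axy; elim=> [//|a /Axy//|g h _ -> _ ->|g h _ -> _ ->].
Qed.

Lemma pf_finite X (K : set F) (I : eqType) (a : I -> X -> F) (D : set I) f :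
  polyfun K [set a i | i in D] f ->
  exists s : seq I, (forall i, i \in s -> D i) /\
    polyfun K [set a i | i in [set i | i \in s]] f.
Proof.
have cat2 g h (s t : seq I) :
    polyfun K [set a i | i in [set i | i \in s]] g ->
    polyfun K [set a i | i in [set i | i \in t]] h ->
    polyfun K [set a i | i in [set i | i \in s ++ t]] g /\
    polyfun K [set a i | i in [set i | i \in s ++ t]] h.
  move=> Pg Ph; split; [apply: pf_sub Pg|apply: pf_sub Ph] => // _ [i /= si <-];
  by exists i => //=; rewrite mem_cat si ?orbT.
elim=> [c Kc|_ [i Di <-]|{}f g _ [s [Ds Ps]] _ [t [Dt Pt]]|
       {}f g _ [s [Ds Ps]] _ [t [Dt Pt]]].
- by exists [::]; split=> //; apply: pf_const.
- exists [:: i]; split; first by move=> j; rewrite inE => /eqP->.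
  by apply: pf_gen; exists i => //=; rewrite inE.
- exists (s ++ t); split; first by move=> i; rewrite mem_cat => /orP[/Ds|/Dt].
  by have [Pf Pg] := cat2 _ _ _ _ Ps Pt; apply: pf_add.
- exists (s ++ t); split; first by move=> i; rewrite mem_cat => /orP[/Ds|/Dt].
  by have [Pf Pg] := cat2 _ _ _ _ Ps Pt; apply: pf_mul.
Qed.

Lemma pf_finite_uniq X (K : set F) (I : eqType) (a : I -> X -> F) (D : set I) f :
  polyfun K [set a i | i in D] f ->
  exists s : seq I, [/\ uniq s, forall i, i \in s -> D i &
    polyfun K [set a i | i in [set i | i \in s]] f].
Proof.
move=> /pf_finite[s [sD Pf]]; exists (undup s); split.
- exact: undup_uniq.
- by move=> i; rewrite mem_undup; apply: sD.
by apply: pf_sub Pf => // _ [i /= si <-]; exists i; rewrite //= mem_undup.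
Qed.

(** Isolating the generator [e] exhibits [f] as a polynomial in [e] whose
    coefficients are polynomials in the other generators. *)
Lemma pf_univariate X (K : set F) (A A0 : set (X -> F)) (e : X -> F) f :
  K 0 -> K 1 -> (forall a, A a -> A0 a \/ a = e) -> polyfun K A f ->
  exists P : X -> {poly F}, (forall i, polyfun K A0 (fun x => (P x)`_i)) /\
    forall x, f x = (P x).[e x].
Proof.
move=> K0 K1 AA0.
have const g : polyfun K A0 g ->
    exists P : X -> {poly F}, (forall i, polyfun K A0 (fun x => (P x)`_i)) /\
    forall x, g x = (P x).[e x].
  move=> Pg; exists (fun x => (g x)%:P); split=> [i|x]; last by rewrite hornerC.
  under eq_fun do rewrite coefC.
  by case: (i == 0)%N => //; apply: pf_const.
elim=> [c Kc|{}f /AA0[]|{}f g _ [P [cP fP]] _ [Q [cQ gQ]]|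
       {}f g _ [P [cP fP]] _ [Q [cQ gQ]]].
- by apply: const; apply: pf_const.
- by move=> A0f; apply: const; apply: pf_gen.
- move=> ->; exists (fun x => 'X); split=> [i|x]; last by rewrite hornerX.
  by rewrite coefX; apply: pf_const; case: (i == 1)%N.
- exists (fun x => P x + Q x); split=> [i|x]; last by rewrite hornerD fP gQ.
  by under eq_fun do rewrite coefD; apply: pf_add.
exists (fun x => P x * Q x); split=> [i|x]; last by rewrite hornerM fP gQ.
under eq_fun do rewrite coefM.
by apply: pf_sum => // j _; apply: pf_mul.
Qed.

Lemma pf_values_ring X (K : set F) (A : set (X -> F)) x
    (R := [set f x | f in polyfun K A]) : K 1 -> K (-1) ->
  [/\ R 1, forall a b, R a -> R b -> R (a - b) &
      forall a b, R a -> R b -> R (a * b)].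
Proof.
move=> K1 KN1; split.
- by exists (fun=> 1) => //; apply: pf_const.
- move=> _ _ [f Pf <-] [g Pg <-]; exists (fun y => f y + (-1) * g y).
    by apply/pf_add/pf_mul => //; apply: pf_const.
  by rewrite mulN1r.
by move=> _ _ [f Pf <-] [g Pg <-]; exists (fun y => f y * g y) => //; apply: pf_mul.
Qed.

Section Generic.
Variables (K : set F) (I : eqType).

Definition coord (i : I) (u : I -> F) := u i.
Definition coords := [set coord i | i in [set: I]].

Definition generic (t : I -> F) : Prop :=
  forall i, ~ aclosure (K `|` [set t j | j in [set j | j != i]]) (t i).

(** One coordinate at a time: as [t i] is transcendental over the others, every
    coefficient of [f], seen as a polynomial in the coordinate [i], vanishes at
    [t]. *)
Lemma generic_vanish t f : K 0 -> K 1 ->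
  generic t -> polyfun K coords f -> f t = 0 -> forall u, f u = 0.
Proof.
move=> K0 K1 gen_t /pf_finite_uniq[s [us _ Pf]].
move: us Pf; elim: s f => [|i s IH] f.
  move=> _ Pf ft u; rewrite -ft.
  by apply: pf_agree Pf => a [].
move=> /= /andP[is_ us] Pf ft u.
have [|P [cP fP]] := @pf_univariate _ K _
  [set coord j | j in [set j | j \in s]] (coord i) f K0 K1 _ Pf.
  move=> a [j /=]; rewrite inE => /orP[/eqP->|js] <-; first by right.
  by left; exists j.
have Pt j : (P t)`_j = 0.
  have [Pt0|/eqP/eqP Pt0] := eqVneq (P t) 0; first by rewrite Pt0 coef0.
  case: (gen_t i); apply: (rel_closed_root (aclosure_closed _) Pt0); last first.
    by apply/rootP; rewrite -[RHS]ft fP.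
  move=> k; apply: (pf_eval (aclosure_closed _) _ _ (cP k)).
    by move=> c Kc; apply: sub_aclosure; left.
  move=> _ [l /= ls <-]; apply: sub_aclosure; right; exists l => //=.
  by apply: contraNneq is_ => <-.
rewrite fP (_ : P u = 0) ?horner0 //; apply/polyP => j; rewrite coef0.
exact: (IH _ us (cP j) (Pt j)).
Qed.

End Generic.
End PolyFun.

(** * Sequences over an infinite type *)

(** A maximal injective partial function from [A] to [C] is defined on all of [A]
    or reaches all of [C]. *)
Lemma comparable_sets T (A C : set T) :
  (exists h : T -> T, {in A &, injective h} /\ forall x, A x -> C (h x)) \/
  (exists h : T -> T, {in C &, injective h} /\ forall x, C x -> A (h x)).
Proof.
pose P := [set R : set (T * T) | [/\ forall x y, R (x, y) -> A x /\ C y,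
  forall x y y', R (x, y) -> R (x, y') -> y = y' &
  forall x x' y, R (x, y) -> R (x', y) -> x = x']].
have [||R [_ [Rdom Rfun Rinj] maxR]] := @Zorn_above _ P set0; first by split.
  move=> D _ DP totD; split.
  - by move=> x y [X /DP[XA _ _]]; apply: XA.
  - by move=> x y y' /(chain_pair totD)/[apply] -[X [/DP[_ Xf _]]]; apply: Xf.
  by move=> x x' y /(chain_pair totD)/[apply] -[X [/DP[_ _ Xi]]]; apply: Xi.
have [Atot|/existsNP[a /not_implyP[Aa /forallNP Ra]]] :=
    pselect (forall x, A x -> exists y, R (x, y)).
  have /choice[h hR] x : exists y, A x -> R (x, y).
    have [Ax|nAx] := pselect (A x); last by exists x.
    by have [y Rxy] := Atot _ Ax; exists y.
  left; exists h; split=> [x y /set_mem/hR Rx /set_mem/hR Ry hxy|x /hR/Rdom[]//].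
  by apply: Rinj Rx _; rewrite hxy.
right; have Ctot y : C y -> exists x, R (x, y).
  move=> Cy; apply: contrapT => /forallNP Ry; apply: (Ra y).
  apply: (maxR (R `|` [set (a, y)])); [exact: subsetUl| |by right].
  split.
  - by move=> u v [/Rdom//|[-> ->]].
  - move=> u v v' [Ruv|[-> ->]] [Ruv'|[]]; first exact: Rfun Ruv Ruv'.
    + by move=> ua; move: Ruv; rewrite ua => /Ra.
    + by move: Ruv' => /Ra.
    + by [].
  - move=> u u' v [Ruv|[-> ->]] [Ruv'|[]]; first exact: Rinj Ruv Ruv'.
    + by move=> _ vy; move: Ruv; rewrite vy => /Ry.
    + by move: Ruv' => /Ry.
    + by [].
have /choice[h hR] y : exists x, C y -> R (x, y).
  have [Cy|nCy] := pselect (C y); last by exists y.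
  by have [x Rxy] := Ctot _ Cy; exists x.
exists h; split=> [x y /set_mem/hR Rx /set_mem/hR Ry hxy|x /hR/Rdom[]//].
by apply: Rfun Rx _; rewrite hxy.
Qed.

Section Square.
Variables (T : Type) (f : nat -> T).
Hypothesis f_inj : injective f.

Let fld (R : set (T * T * T)) : set T :=
  [set x | exists p, R p /\ (x = p.1.1 \/ x = p.1.2 \/ x = p.2)].

Let pairing (R : set (T * T * T)) : Prop :=
  [/\ forall p z z', R (p, z) -> R (p, z') -> z = z',
      forall p p' z, R (p, z) -> R (p', z) -> p = p' &
      forall x y, fld R x -> fld R y -> exists z, R ((x, y), z)].

(** Zorn's lemma gives a maximal subset [A] with an embedding [g] of its square into
    itself. If the complement of [A] embeds in [A], then [T] embeds in two copies
    of [A], hence in [A], and its square embeds in [A] as well. Otherwise [A] has a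
    disjoint copy [h A], and [g] extends to the union of [A] and [h A] by sending
    the three new blocks of the square into [h A], contradicting maximality. *)
Lemma square_embedding : exists g : T * T -> T, injective g.
Proof.
pose R0 : set (T * T * T) := [set (f mn.1, f mn.2, f (pickle mn)) | mn in setT].
have pR0 : pairing R0.
  split.
  - move=> p z z' [[m n] _ /= [<- <-]] [[m' n'] _ /= [/f_inj mm' /f_inj nn' <-]].
    by rewrite mm' nn'.
  - move=> p p' z [[m n] _ /= [<- <-]] [[m' n'] _ /= [<- /f_inj]].
    by move/(pcan_inj (@pickleK _)) => [-> ->].
  have fldf x : fld R0 x -> exists n, x = f n.
    by move=> [_ [[mn _ <-] /= []]]; [exists mn.1|case; eexists; eauto].
  move=> _ _ /fldf[m ->] /fldf[n ->]; exists (f (pickle (m, n))).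
  by exists (m, n).
have [||R [R0R [Rfun Rinj Rtot] maxR]] := @Zorn_above _ pairing R0; first by [].
  move=> D _ DP totD.
  have two p q := @chain_pair _ D p q totD.
  split.
  - by move=> p z z' /two/[apply] -[X [/DP[Xf _ _]]]; apply: Xf.
  - by move=> p p' z /two/[apply] -[X [/DP[_ Xi _]]]; apply: Xi.
  move=> x y [p [pD xp]] [q [qD yq]]; have [X [DX Xp Xq]] := two _ _ pD qD.
  have [_ _ Xt] := DP _ DX.
  have [||z Xz] := Xt x y; first by exists p.
    by exists q.
  by exists z, X.
pose A := fld R.
have Af n : A (f n).
  exists (f n, f 0%N, f (pickle (n, 0%N))); split; last by left.
  by apply: R0R; exists (n, 0%N).
have /choice[g gR] p : exists z, A p.1 -> A p.2 -> R (p, z).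
  case: p => x y /=.
  have [Ax|] := pselect (A x); last by exists x.
  have [Ay|] := pselect (A y); last by exists x.
  by have [z Rz] := Rtot _ _ Ax Ay; exists z.
have Ag x y : A x -> A y -> A (g (x, y)).
  by move=> Ax Ay; exists ((x, y), g (x, y)); split; [apply: gR|right; right].
have gI x y x' y' : A x -> A y -> A x' -> A y' -> g (x, y) = g (x', y') ->
    x = x' /\ y = y'.
  move=> Ax Ay Ax' Ay' eg.
  have Rxy := gR (x, y) Ax Ay; have := gR (x', y') Ax' Ay'.
  by rewrite -eg => /(Rinj _ _ _ Rxy)[].
pose a (e : bool) := f e.
have Aa e : A (a e) by apply: Af.
have Agg e e' x y : A x -> A y -> A (g (g (a e, a e'), g (x, y))).
  by move=> Ax Ay; apply: (Ag _ _ (Ag _ _ (Aa e) (Aa e')) (Ag _ _ Ax Ay)).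
have aI : injective a by move=> [] [] /f_inj.
have [[h [hI hA]]|[h [hI hA]]] := comparable_sets A (~` A); last first.
  pose j x := if `[< A x >] then g (a true, x) else g (a false, h x).
  have Aj x : A (j x).
    by rewrite /j; case: asboolP => [Ax|nAx]; apply: Ag => //; apply: hA.
  have jI : injective j.
    move=> x y; rewrite /j; case: asboolP => Ax; case: asboolP => Ay.
    - by case/gI => //.
    - by case/gI => // [|/aI//]; apply: hA.
    - by case/gI => // [|/aI//]; apply: hA.
    - case/gI => //; [exact: hA|exact: hA|move=> _].
      by apply: hI; apply/mem_set.
  exists (fun p => g (j p.1, j p.2)) => -[x y] [x' y'] /= /gI[//|//|//|//|].
  by move=> /jI -> /jI ->.
(* The boolean tells the copy of A apart from A itself; G stores the two tags of
   a pair along with its components, using the labels a. *)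
pose hh (e : bool) x := if e then h x else x.
have hhI e x e' x' : A x -> A x' -> hh e x = hh e' x' -> e = e' /\ x = x'.
  move=> Ax Ax'; case: e; case: e' => //= exx'.
  - by split => //; apply: hI exx'; apply/mem_set.
  - by case: (hA _ Ax); rewrite exx'.
  - by case: (hA _ Ax'); rewrite -exx'.
pose G (e e' : bool) x y :=
  if e || e' then h (g (g (a e, a e'), g (x, y))) else g (x, y).
have GI e1 e1' x1 y1 e2 e2' x2 y2 : A x1 -> A y1 -> A x2 -> A y2 ->
    G e1 e1' x1 y1 = G e2 e2' x2 y2 -> [/\ e1 = e2, e1' = e2', x1 = x2 & y1 = y2].
  move=> Ax1 Ay1 Ax2 Ay2; rewrite /G.
  case: (boolP (e1 || e1')) => E1; case: (boolP (e2 || e2')) => E2 eG.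
  - have /gI[] : g (g (a e1, a e1'), g (x1, y1)) = g (g (a e2, a e2'), g (x2, y2)).
      apply: (hI _ _ _ _ eG); apply/mem_set; exact: Agg.
    1-4: by apply: Ag => //; apply: Aa.
    by case/gI => // /aI -> /aI ->; case/gI => // -> ->.
  - by case: (hA (g (g (a e1, a e1'), g (x1, y1)))); [apply: Agg|rewrite eG; apply: Ag].
  - by case: (hA (g (g (a e2, a e2'), g (x2, y2)))); [apply: Agg|rewrite -eG; apply: Ag].
  - move: E1 E2; rewrite !negb_or => /andP[/negPf-> /negPf->] /andP[/negPf-> /negPf->].
    by case: (gI _ _ _ _ Ax1 Ay1 Ax2 Ay2 eG).
pose R' : set (T * T * T) := [set q | exists e e' x y, [/\ A x, A y &
   q = (hh e x, hh e' y, G e e' x y)]].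
have RR' : R `<=` R'.
  move=> [[x y] z] Rz.
  have Ax : A x by exists (x, y, z); split => //; left.
  have Ay : A y by exists (x, y, z); split => //; right; left.
  exists false, false, x, y; split=> //; rewrite /G /=; congr pair.
  by apply: Rfun Rz _; apply: gR.
suff /maxR : pairing R'.
  move=> /(_ RR') R'R; case: (hA (f 0%N) (Af 0%N%N)).
  exists (hh true (f 0%N), hh true (f 0%N), G true true (f 0%N) (f 0%N)).
  split; last by left.
  by apply: R'R; exists true, true, (f 0%N), (f 0%N); split.
have fldR' u : fld R' u -> exists e x, A x /\ u = hh e x.
  move=> [_ [[e [e' [x [y [Ax Ay ->]]]]]]] /= [->|[->|->]].
  - by exists e, x.
  - by exists e', y.
  - rewrite /G; case: (e || e').
      by exists true, (g (g (a e, a e'), g (x, y))); split => //; apply: Agg.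
    by exists false, (g (x, y)); split => //; apply: Ag.
split.
- move=> p z z' [e1 [e1' [x1 [y1 [Ax1 Ay1 [-> ->]]]]]].
  move=> [e2 [e2' [x2 [y2 [Ax2 Ay2 []]]]]].
  by move=> /hhI[//|//|-> ->] /hhI[//|//|-> ->] ->.
- move=> p p' z [e1 [e1' [x1 [y1 [Ax1 Ay1 [-> ->]]]]]].
  move=> [e2 [e2' [x2 [y2 [Ax2 Ay2 [-> ]]]]]].
  by move=> /GI[//|//|//|//|-> -> -> ->].
move=> _ _ /fldR'[e [x [Ax ->]]] /fldR'[e' [y [Ay ->]]].
by exists (G e e' x y), e, e', x, y.
Qed.

Lemma seq_embedding : exists g : seq (nat + T) -> T, injective g.
Proof.
have [g gI] := square_embedding.
pose k (c : nat + T) :=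
  match c with inl n => g (f 0%N, f n) | inr x => g (f 1%N, x) end.
have kI : injective k.
  by move=> [m|x] [n|y] /gI[] => [/f_inj->|/f_inj|/f_inj|->].
pose enc := foldr (fun c z => g (k c, z)) (f 0%N).
(* The length is recorded because enc alone does not mark the end of s. *)
exists (fun s => g (f (size s), enc s)) => s t /gI[/f_inj].
elim: s t => [|c s IH] [|d t] //= [st] /gI[/kI-> /IH ->] //.
Qed.

End Square.

(** * A tower of closed subfields with independent elements *)

Section Ratr.
Variable F : fieldType.
Hypothesis F0 : [pchar F] =i pred0.

Lemma intr_neq0 (a : int) : a != 0 -> a%:~R != 0 :> F.
Proof.
have /pcharf0P natF := F0.
case: a => n; rewrite ?NegzE ?mulrNz ?oppr_eq0 ?pmulrn => n0.
  by rewrite -pmulrn natF.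
by rewrite -pmulrn natF.
Qed.

Lemma ratr_div (x : rat) (a b : int) :
  b != 0 -> x * b%:~R = a%:~R -> ratr x = a%:~R / b%:~R :> F.
Proof.
move=> b0 xab; rewrite /ratr; apply/eqP.
rewrite eqr_div ?intr_neq0 ?denq_neq0 // -!intrM; apply/eqP; congr intmul.
by apply: (@intr_inj rat); rewrite !intrM -xab numqE; ring.
Qed.

Fact ratr_zmod : zmod_morphism (@ratr F).
Proof.
move=> x y; rewrite (@ratr_div (x - y)
  (numq x * denq y - numq y * denq x) (denq x * denq y)).
- rewrite /ratr -(mulNr (numq y)%:~R) addf_div ?intr_neq0 ?denq_neq0 // mulNr.
  by rewrite !(intrM, intrB).
- by rewrite mulf_neq0 ?denq_neq0.
by rewrite !(intrM, intrB) !numqE; ring.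
Qed.

Fact ratr_monoid : monoid_morphism (@ratr F).
Proof.
split=> [|x y]; first by rewrite (@ratr_div 1 1 1) // divr1.
rewrite (@ratr_div (x * y) (numq x * numq y) (denq x * denq y)).
- by rewrite /ratr !intrM mulf_div.
- by rewrite mulf_neq0 ?denq_neq0.
by rewrite !intrM !numqE; ring.
Qed.

(** In characteristic zero the denominators of rational numbers are invertible in
    [F], so that [ratr] respects the ring operations. *)
Lemma ratr_rmorphism : exists f : {rmorphism rat -> F}, (f : rat -> F) = ratr.
Proof.
pose zm := GRing.isZmodMorphism.Build rat F (@ratr F) ratr_zmod.
pose mm := GRing.isMonoidMorphism.Build rat F (@ratr F) ratr_monoid.
pose f : {rmorphism rat -> F} := HB.pack (@ratr F) zm mm.
by exists f.
Qed.

End Ratr.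

Section Transcendence.
Variable F : closedFieldType.
Hypothesis F0 : [pchar F] =i pred0.

Local Notation Q := (range (@ratr F)).

Lemma Q_intr (a : int) : Q a%:~R.
Proof. by exists a%:~R => //; rewrite ratr_int. Qed.

Lemma rel_closed_ratr (K : set F) r : rel_closed K -> K (ratr r).
Proof.
move=> Kr; apply: rel_closedM => //; first exact: rel_closed_int.
by apply: rel_closedV => //; apply: rel_closed_int.
Qed.

Lemma pf_mpoly (I : eqType) (s : seq I) (f : (I -> F) -> F) : uniq s ->
  polyfun Q [set @coord F I i | i in [set i | i \in s]] f ->
  exists p : mpoly (size s) rat,
    forall u, f u = mmap (ratr : rat -> F) (fun k => u (tnth (in_tuple s) k)) p.
Proof.
move=> us; have [phi phiE] := ratr_rmorphism F0; rewrite -phiE.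
elim=> [_ [r _ <-]|_ [i /= si <-]|{}f g _ [p fp] _ [q gq]|{}f g _ [p fp] _ [q gq]].
- by exists (mpolyC _ r) => u; rewrite mmapC.
- have /seq_tnthP[k ->] := si.
  by exists (mpolyX _ (mnm1 k)) => u; rewrite mmapX mmap1U.
- by exists (p + q) => u; rewrite mmapD fp gq.
- by exists (p * q) => u; rewrite fp gq [RHS]rmorphM.
Qed.

(** Points are here functions from [F] to [F], with one coordinate for each element
    of [F]; the tautological point [id] has coordinate [b] equal to [b]. *)
Lemma alg_indep_vanish (B : set F) f : alg_indep B ->
  polyfun Q [set @coord F F b | b in B] f -> f id = 0 -> forall u, f u = 0.
Proof.
move=> indB /pf_finite_uniq[s [us sB]].
move=> /(pf_mpoly us)[p fp]; rewrite fp => /indB p0 u.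
have [phi phiE] := ratr_rmorphism F0.
rewrite fp p0 -?phiE ?mmap0 //.
  by apply/tuple_uniqP.
by move=> k; apply: sB; rewrite mem_tnth.
Qed.

(** Suppose that [b] satisfies an equation over the ring generated by the rest of
    [B], with a nonzero constant term. It says that a polynomial function vanishes
    at [id]; this function is thus zero, whereas changing the coordinate [b] to 0
    leaves the constant term of the equation. *)
Lemma alg_indep_free (B : set F) (b : F) :
  alg_indep B -> B b -> ~ aclosure (B `\ b) b.
Proof.
move=> indB Bb clb; set A := B `\ b in clb.
pose CA := [set @coord F F a | a in A]; pose CB := [set @coord F F a | a in B].
have PAB f : polyfun Q CA f -> polyfun Q CB f.
  by apply: pf_sub => // _ [a [Ba _] <-]; exists a.
pose R := [set f id | f in polyfun Q CA].
have Q1 : Q 1 by apply: (Q_intr 1).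
have Q0 : Q 0 by apply: (Q_intr 0).
have [R1 RB RM] : [/\ R 1, forall x y, R x -> R y -> R (x - y) &
    forall x y, R x -> R y -> R (x * y)].
  by apply: pf_values_ring => //; apply: (Q_intr (-1)).
have b0 : b != 0.
  apply/eqP => b0; have Pb : polyfun Q CB (@coord F F b) by apply: pf_gen; exists b.
  have /eqP := alg_indep_vanish indB Pb b0 (fun=> 1).
  by rewrite /coord oner_eq0.
have clRb : aclosure R b.
  apply: aclosure_sub clb => a Aa; exists (@coord F F a) => //.
  by apply: pf_gen; exists a.
have [q [q0 Rq qb]] := algebraic_over_ring R1 RB RM clRb b0.
have /choice[f fP] i : exists f, polyfun Q CA f /\ f id = q`_i.
  by have [f Pf fq] := Rq i; exists f.
pose h (u : F -> F) := \sum_(i < size q) f i u * u b ^+ i.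
have Ph : polyfun Q CB h.
  apply: pf_sum => // i _; apply: pf_mul; first by apply: PAB; apply: (fP i).1.
  by apply: pf_exp => //; apply: pf_gen; exists b.
have hc c : h (fun x => if x == b then c else x) = q.[c].
  rewrite horner_coef; apply: eq_bigr => i _; rewrite eqxx; congr (_ * _).
  rewrite -(fP i).2; apply: pf_agree (fP i).1 => _ [a [_ /eqP ab] <-].
  by rewrite /coord (negPf ab).
have h0 : h id = 0.
  rewrite -[RHS](rootP qb) horner_coef; apply: eq_bigr => i _.
  by rewrite (fP i).2.
have := hc 0; rewrite (alg_indep_vanish indB Ph h0) horner_coef0 => /esym/eqP.
by rewrite (negPf q0).
Qed.

(** An element [x] outside the closure of [B] could be added to [B]: in a relation
    over [B] the element [x], being transcendental, may be replaced by any other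
    value, in particular by an element of [B] that the relation does not
    involve. *)
Lemma transcendence_basis_span (B : set F) :
  transcendence_basis B -> infinite_set B -> aclosure B = setT.
Proof.
move=> [indB maxB] infB; rewrite eqEsubset; split=> // x _.
apply: contrapT => nx; pose C := B `|` [set x].
suff indC : alg_indep C.
  have CB := maxB C (@subsetUl _ _ _) indC.
  by apply: nx; apply: sub_aclosure; rewrite -CB; right.
move=> m a a_inj aC p pa0.
have [[i0 ai0]|nai] := pselect (exists i, a i = x); last first.
  apply: (indB m a a_inj _ p pa0) => i.
  by have [//|aix] := aC i; case: nai; exists i.
have aB i : i != i0 -> B (a i).
  move=> ii0; have [//|aix] := aC i; case/eqP: ii0.
  by apply: a_inj; rewrite ai0.
pose a' c i := if i == i0 then c else a i.
pose f (u : unit -> F) := mmap (ratr : rat -> F) (a' (u tt)) p.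
have clr := aclosure_closed B.
have Pf : polyfun (aclosure B) (@coords F unit) f.
  apply: pf_sum => [|mn _]; first exact: (rel_closed0 clr).
  apply: pf_mul; first by apply: pf_const; apply: rel_closed_ratr.
  rewrite /mmap1; elim: (index_enum _) => [|i s IH].
    by under eq_fun do rewrite big_nil; apply: pf_const; apply: (rel_closed1 clr).
  under eq_fun do rewrite big_cons; apply: pf_mul => //.
  apply: pf_exp; first exact: (rel_closed1 clr).
  rewrite /a'; case: eqP => [_|/eqP ii0]; first by apply: pf_gen; exists tt.
  by apply: pf_const; apply: sub_aclosure; apply: aB.
have genx : generic (aclosure B) (fun _ : unit => x).
  move=> []; rewrite (_ : [set _ | _ in _] = set0) ?setU0.
    by move=> /(aclosure_min clr (@subset_refl _ _)).
  by rewrite -subset0 => y [[]].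
have f0 : f (fun=> x) = 0.
  rewrite -pa0 /f; congr mmap; apply/funext => i; rewrite /a'.
  by case: eqP => [->|].
have fv := generic_vanish (rel_closed0 clr) (rel_closed1 clr) genx Pf f0.
have [b [Bb nab]] : exists b, B b /\ forall i, a i != b.
  have [b [Bb nb]] : (B `\` [set a i | i in setT]) !=set0.
    apply: infinite_setN0; apply: infinite_setD => //.
    exact: finite_image.
  by exists b; split=> // i; apply/eqP => ab; apply: nb; exists i.
apply: (indB m (a' b)) (fv (fun=> b)).
  move=> i j; rewrite /a'; case: eqP => [->|ni]; case: eqP => [->|nj] //.
  - by move/eqP; rewrite eq_sym (negPf (nab _)).
  - by move/eqP; rewrite (negPf (nab _)).
  - exact: a_inj.
by move=> i; rewrite /a'; case: eqP => // /eqP; apply: aB.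
Qed.

Section TreeValue.
Variables (T : Type) (v : T -> F).

Definition poly_roots (p : {poly F}) : seq F := sval (closed_field_poly_normal p).

Lemma poly_rootsP (p : {poly F}) x : p != 0 -> root p x -> x \in poly_roots p.
Proof.
rewrite /poly_roots => p0 px; case: closed_field_poly_normal => s /= ps.
by move: px; rewrite ps rootZ ?lead_coef_eq0 // root_prod_XsubC.
Qed.

(** Trees with leaves in [T] name the elements of the closure of the range of [v],
    which bounds its cardinality. A node with label [k.+3] denotes the root number
    [k] of the polynomial whose coefficients are named by its children. *)
Fixpoint tree_value (t : GenTree.tree T) : F :=
  match t with
  | GenTree.Leaf x => v x
  | GenTree.Node n s =>
    let w := map tree_value s in
    match n with
    | 0 => 1
    | 1 => w`_0 - w`_1
    | 2 => w`_0 * w`_1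
    | k.+3 => (poly_roots (Poly w))`_k
    end
  end.

Lemma range_tree_value_closed : rel_closed (range tree_value).
Proof.
split.
- by exists (GenTree.Node 0 [::]).
- by move=> _ _ [s _ <-] [t _ <-]; exists (GenTree.Node 1 [:: s; t]).
- by move=> _ _ [s _ <-] [t _ <-]; exists (GenTree.Node 2 [:: s; t]).
move=> q x q0 qv qx; have /choice[c cq] i : exists t, tree_value t = q`_i.
  by have [t _] := qv i; exists t.
exists (GenTree.Node (index x (poly_roots q)).+3 (mkseq c (size q))) => //=.
rewrite -map_comp (eq_map cq) -/(mkseq _ _) mkseq_nth polyseqK nth_index //.
exact: poly_rootsP.
Qed.

End TreeValue.
End Transcendence.

Section Tower.
Variable F : closedFieldType.
Hypothesis F0 : [pchar F] =i pred0.

Lemma rel_closed_union (K : nat -> set F) :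
  (forall i, rel_closed (K i)) -> (forall i, K i `<=` K i.+1) ->
  rel_closed [set x | exists i, K i x].
Proof.
move=> Kr KS.
split.
- by exists 0%N; apply: rel_closed1.
- move=> x y [i Kx] [j Ky]; exists (maxn i j).
  apply: rel_closedB => //; first by apply: tower_le Kx => //; apply: leq_maxl.
  by apply: tower_le Ky => //; apply: leq_maxr.
- move=> x y [i Kx] [j Ky]; exists (maxn i j).
  apply: rel_closedM => //; first by apply: tower_le Kx => //; apply: leq_maxl.
  by apply: tower_le Ky => //; apply: leq_maxr.
move=> q x q0 /choice[h hq] qx; exists (\max_(i < size q) h i)%N.
apply: (rel_closed_root (Kr _) q0 _ qx) => i; have [iq|qi] := ltnP i (size q).
  by apply: tower_le (hq i) => //; apply: (leq_bigmax (Ordinal iq)).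
by rewrite nth_default //; apply: rel_closed0.
Qed.

(** The elements of [F] are named by trees over the transcendence basis [B], and
    these trees embed in [B]; hence [B] contains disjoint copies [tau i] of
    ['M[F]_N * nat]. The field [K i] is the closure of what remains of [B] once
    the copies of index at least [i] are removed. *)
Lemma generic_tower (N : nat) : infinite_trdeg F ->
  exists (K : nat -> set F) (t : nat -> 'M[F]_N * nat -> F),
    [/\ forall i, rel_closed (K i), forall i, K i `<=` K i.+1,
        forall x, exists i, K i x, forall i, generic (K i) (t i) &
        forall i x, K i.+1 (t i x)].
Proof.
move=> [B tB infB]; have spanB := transcendence_basis_span tB infB.
have freeB b : B b -> ~ aclosure (B `\ b) b by apply: alg_indep_free tB.1.
pose T := {b | B b}.
have svalI (a b : T) : sval a = sval b -> a = b.
  case: a b => [a pa] [b pb] /= ab; subst b.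
  by rewrite (Prop_irrelevance pa pb).
have [f fB fI] : exists2 f : nat -> F, forall n, B (f n) & injective f.
  have /infiniteP/card_leP/injfunPex[f _ fI] := infB.
  pose toT (n : nat) : [set: nat] := SigSub (mem_set (I : [set: nat] n)).
  exists (fun n => sval (f (toT n))) => [n|m n /val_inj fmn].
    exact/set_mem/(valP (f (toT n))).
  have := fI _ _ (mem_set (I : setT (toT m))) (mem_set (I : setT (toT n))) fmn.
  by move=> /(congr1 val).
have [g gI] := @seq_embedding T (fun n => exist _ (f n) (fB n))
  (fun m n e => fI _ _ (congr1 sval e)).
pose v (b : T) : F := sval b.
have rangeT x : exists s, tree_value v s = x.
  have : aclosure B x by rewrite spanB.
  move=> /(_ (range (tree_value v))) [|b Bb|s _ <-]; last by exists s.
    exact: range_tree_value_closed.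
  by exists (GenTree.Leaf (exist _ b Bb)).
have /choice[s sK] := rangeT.
pose beta x : T := g (GenTree.encode (s x)).
have betaI : injective beta.
  by move=> x y /gI/(pcan_inj (GenTree.codeK T))/(congr1 (tree_value v)); rewrite !sK.
pose theta (M : 'M[F]_N) : T :=
  g [seq inr (beta (M p.1 p.2)) | p <- enum {: 'I_N * 'I_N}].
have thetaI : injective theta.
  move=> M M' /gI/eq_in_map MM'; apply/matrixP => i j.
  by have := MM' (i, j); rewrite mem_enum => /(_ isT) /= [/betaI].
pose tau (i : nat) (x : 'M[F]_N * nat) : T :=
  g [:: inl i; inr (theta x.1); inl x.2].
have tauI i x j y : tau i x = tau j y -> i = j /\ x = y.
  by case: x y => [M m] [M' m'] /gI[-> /thetaI -> ->].
pose A i := [set b | B b /\ forall j x, (i <= j)%N -> b != sval (tau j x)].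
exists (fun i => aclosure (A i)), (fun i x => sval (tau i x)); split.
- by move=> i; apply: aclosure_closed.
- move=> i; apply: aclosure_sub => b [Bb nb]; split=> // j x ij.
  by apply: nb; apply: ltnW.
- move=> x; have : aclosure B x by rewrite spanB.
  move=> /(_ [set x | exists i, aclosure (A i) x]); apply.
    apply: rel_closed_union => i; first exact: aclosure_closed.
    by apply: aclosure_sub => b [Bb nb]; split=> // j y ij; apply: nb; apply: ltnW.
  move=> b Bb; have [[i [y bt]]|nb] := pselect (exists i y, b = sval (tau i y)).
    exists i.+1; apply: sub_aclosure; split=> // j z ij; apply/eqP; rewrite bt.
    move=> e; have /tauI[ij' _] : tau i y = tau j z.
      exact: svalI.
    by rewrite ij' ltnn in ij.
  exists 0%N; apply: sub_aclosure; split=> // j z _.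
  by apply/eqP => bt; apply: nb; exists j, z.
- move=> i x clx; apply: (freeB _ (svalP (tau i x))).
  apply: (aclosure_min (aclosure_closed _) _ clx) => c [|[y /= yx <-]].
    apply: aclosure_sub => b [Bb nb]; split=> // bt.
    by have := nb i x (leqnn i); rewrite bt eqxx.
  apply: sub_aclosure; split; first exact: svalP.
  move=> e; have /tauI[_ xy] : tau i y = tau i x by apply: svalI.
  by rewrite xy eqxx in yx.
move=> i x; apply: sub_aclosure; split; first exact: svalP.
move=> j y ij; apply/eqP => e; have /tauI[ij' _] : tau i x = tau j y by apply: svalI.
by rewrite ij' ltnn in ij.
Qed.

End Tower.

(** * Words in one-parameter subgroups *)

Lemma generic_reindex (F : fieldType) (K : set F) (I J : eqType) (phi : J -> I)
    (t : I -> F) :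
  injective phi -> generic K t -> generic K (fun j => t (phi j)).
Proof.
move=> phiI gt j clj; apply: (gt (phi j)); apply: aclosure_sub clj.
apply: setUS => _ [k /= kj <-]; exists (phi k) => //=.
by apply: contraNneq kj => /phiI->.
Qed.

Lemma pf_constants (F : fieldType) X (K : nat -> set F) (A : set (X -> F)) f :
  (forall i, K i `<=` K i.+1) -> (forall x, exists i, K i x) ->
  polyfun setT A f -> exists i, polyfun (K i) A f.
Proof.
move=> KS KT.
have two g h i j : polyfun (K i) A g -> polyfun (K j) A h ->
    polyfun (K (maxn i j)) A g /\ polyfun (K (maxn i j)) A h.
  move=> Pg Ph; split; [apply: pf_sub Pg|apply: pf_sub Ph] => //.
    by apply: tower_le => //; apply: leq_maxl.
  by apply: tower_le => //; apply: leq_maxr.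
elim=> [c _|{}f Af|{}f g _ [i Pf] _ [j Pg]|{}f g _ [i Pf] _ [j Pg]].
- by have [i Kc] := KT c; exists i; apply: pf_const.
- by exists 0%N; apply: pf_gen.
- by exists (maxn i j); have [? ?] := two _ _ _ _ Pf Pg; apply: pf_add.
- by exists (maxn i j); have [? ?] := two _ _ _ _ Pf Pg; apply: pf_mul.
Qed.

Section Words.
Variables (F : fieldType) (N : nat) (V : Type) (P : V -> F -> 'M[F]_N).
Local Notation Z := (range (fun a : int => a%:~R : F)).

Hypothesis P0 : forall v, P v 0 = 1%:M.
Hypothesis PD : forall v s t, P v (s + t) = P v s *m P v t.
Hypothesis P_poly : forall v k l, polyfun Z [set id] (fun t => P v t k l).

(** The first letter takes the last parameter, so that a word and its suffixes
    read the same parameters. *)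
Fixpoint word (w : seq V) (u : nat -> F) : 'M[F]_N :=
  if w is v :: w' then P v (u (size w')) *m word w' u else 1%:M.

Definition words : set 'M[F]_N := [set h | exists w u, h = word w u].

Lemma word_agree w u u' :
  (forall j, (j < size w)%N -> u j = u' j) -> word w u = word w u'.
Proof.
elim: w => //= v w IH uu'; rewrite uu' // IH // => j jw.
by apply: uu'; apply: ltnW.
Qed.

Lemma word_cat w w' u :
  word (w ++ w') u = word w (fun j => u (j + size w')%N) *m word w' u.
Proof. by elim: w => [|v w IH] /=; rewrite ?mul1mx // IH mulmxA size_cat. Qed.

Lemma word0 w u : (forall j, (j < size w)%N -> u j = 0) -> word w u = 1%:M.
Proof.
elim: w => //= v w IH u0; rewrite u0 // P0 mul1mx IH // => j jw.
by apply: u0; apply: ltnW.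
Qed.

Lemma word_glue w w' u u' :
  word w u *m word w' u' =
  word (w ++ w') (fun j => if (j < size w')%N then u' j else u (j - size w')%N).
Proof.
rewrite word_cat; congr (_ *m _); last by apply: word_agree => j ->.
by apply: word_agree => j _; rewrite ltnNge leq_addl addnK.
Qed.

Lemma words1 : words 1%:M.
Proof. by exists [::], (fun=> 0). Qed.

Lemma wordsM g h : words g -> words h -> words (g *m h).
Proof. by move=> [w [u ->]] [w' [u' ->]]; rewrite word_glue; do 2 eexists. Qed.

Lemma words_letter v t : words (P v t).
Proof. by exists [:: v], (fun=> t); rewrite /= mulmx1. Qed.

Lemma P_opp_mul v t : P v (- t) *m P v t = 1%:M.
Proof. by rewrite -PD addNr P0. Qed.

Lemma words_inv g : words g -> exists2 h, words h & h *m g = 1%:M.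
Proof.
move=> [w [u ->]]; elim: w => [|v w [h wh hw]] /=.
  by exists 1%:M; rewrite ?mulmx1 //; apply: words1.
exists (h *m P v (- u (size w))).
  by apply: wordsM => //; apply: words_letter.
by rewrite mulmxA -[_ *m P v (u _)]mulmxA P_opp_mul mulmx1.
Qed.

Lemma words_map (s : {rmorphism F -> F}) g :
  (forall v t, map_mx s (P v t) = P v (s t)) ->
  words g -> words (map_mx s g).
Proof.
move=> P_map [w [u ->]]; exists w, (fun j => s (u j)); elim: w => /= [|v w <-].
  exact: map_mx1.
by rewrite map_mxM P_map.
Qed.

Lemma word_poly w k l : polyfun Z (@coords F nat) (fun u => word w u k l).
Proof.
have Z0 : Z 0 by exists 0.
elim: w k l => [|v w IH] k l /=.
  by apply: pf_const; rewrite mxE; exists (k == l : nat)%:Z => //; case: eqP.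
rewrite (_ : (fun u => _) = fun u : nat -> F =>
    \sum_j P v (u (size w)) k j * word w u j l); last first.
  by apply/funext => u; rewrite mxE.
apply: pf_sum => // j _; apply: pf_mul => //.
apply: (@pf_comp F F (nat -> F) (fun u => u (size w)) Z Z [set id] _
  (fun t => P v t k j)) => //.
by move=> a ->; apply: pf_gen; exists (size w).
Qed.

Definition entry (p : 'I_N * 'I_N) (h : 'M[F]_N) : F := h p.1 p.2.
Definition entries (S : {set 'I_N * 'I_N}) :=
  [set entry p | p in [set p | p \in S]].

Lemma pf_word (K : set F) S w c : Z `<=` K -> polyfun K (entries S) c ->
  polyfun K (@coords F nat) (fun u => c (word w u)).
Proof.
move=> ZK; apply: pf_comp => // _ [p _ <-].
by apply: pf_sub (word_poly w p.1 p.2).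
Qed.

(** The entries in [S] satisfy no more relations on the image of [w] than on all
    words; when [S] is full, the image of [w] is Zariski dense. *)
Definition dominant S w := forall c, polyfun setT (entries S) c ->
  (forall u, c (word w u) = 0) -> forall h, words h -> c h = 0.

Lemma word_prefix0 w w' u :
  word w u = word (w' ++ w) (fun j => if (j < size w)%N then u j else 0).
Proof.
rewrite word_cat (@word0 w') ?mul1mx; first by apply: word_agree => j ->.
by move=> j _; rewrite ltnNge leq_addl.
Qed.

Lemma dominant_cat S w w' : dominant S w -> dominant S (w' ++ w).
Proof.
by move=> domS c Pc cw; apply: domS => // u; rewrite (word_prefix0 w w').
Qed.

Variables (K : nat -> set F) (t : nat -> nat -> F).
Hypothesis Kr : forall i, rel_closed (K i).
Hypothesis KS : forall i, K i `<=` K i.+1.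
Hypothesis KT : forall x, exists i, K i x.
Hypothesis gen_t : forall i, generic (K i) (t i).

Lemma ZK i : Z `<=` K i.
Proof. by move=> _ [a _ <-]; apply: rel_closed_int. Qed.

(** A dimension argument. Let [S] be a largest set of entries for which some word
    [w] is dominant. Suppose that [c] vanishes on the image of [w], but not at the
    value [h] of another word [w'], and let [z] be a generic value of
    [w1 := w' ++ w]. By maximality of [S] every entry of [z] is algebraic over the
    entries in [S], hence so is [c z], which is nonzero because [w1] specialises
    to [h]. Take an equation of [c z] over the entries in [S] with nonzero constant
    term. It holds identically on the image of [w1], which contains that of [w];
    there [c] vanishes, and so does the constant term. By dominance of [S] the
    constant term vanishes at [z] too, a contradiction. *)
Lemma dominant_word : exists w, dominant [set: _] w.
Proof.
pose good n := `[< exists S w, dominant S w /\ #|S| = n >].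
have good0 : exists n, good n.
  exists 0%N; apply/asboolP; exists finset.set0, [::]; split; last exact: cards0.
  move=> c Pc c0 h _; rewrite -(c0 (fun=> 0)); apply: pf_agree Pc.
  by move=> a [p /=]; rewrite finset.inE.
have good_le n : good n -> (n <= #|{: 'I_N * 'I_N}|)%N.
  by move=> /asboolP[S [w [_ <-]]]; apply: max_card.
case: (ex_maxnP good0 good_le) => n /asboolP[S [w [domS <-]]] maxS.
exists w => c Pc cw h [w' [d hd]]; apply: contrapT => /eqP ch0.
set w1 := w' ++ w; have domS1 : dominant S w1 by apply: dominant_cat.
(* For e outside S, a relation between e and S on the image of w1 that does not
   hold on all words, with coefficients in some level of the tower. *)
have /choice[lev levP] (e : 'I_N * 'I_N) : exists i, e \in S \/
    exists c', [/\ polyfun (K i) (entries (e |: S)) c',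
      forall u, c' (word w1 u) = 0 & exists2 h', words h' & c' h' != 0].
  have [eS|eS] := boolP (e \in S); first by exists 0%N; left.
  have /existsNP[c' /not_implyP[Pc' /not_implyP[c'0]]] : ~ dominant (e |: S) w1.
    move=> domeS; have : (#|e |: S| <= #|S|)%N.
      by apply: maxS; apply/asboolP; exists (e |: S), w1.
    by rewrite cardsU1 eS ltnn.
  move=> /existsNP[h' /not_implyP[wh' /eqP c'h']].
  have [i Pi] := pf_constants KS KT Pc'.
  by exists i; right; exists c'; split => //; exists h'.
have [i0 Pc0] := pf_constants KS KT Pc.
pose i := maxn i0 (\max_e lev e).
have Pci : polyfun (K i) (entries [set: _]) c.
  by apply: pf_sub Pc0 => //; apply: tower_le => //; apply: leq_maxl.
pose z := word w1 (t i).
have K0 := rel_closed0 (Kr i); have K1 := rel_closed1 (Kr i).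
have vanish S' f : polyfun (K i) (entries S') f -> f z = 0 ->
    forall u, f (word w1 u) = 0.
  move=> Pf; apply: (generic_vanish K0 K1 (@gen_t i)).
  by apply: pf_word Pf; apply: ZK.
pose R := [set f z | f in polyfun (K i) (entries S)].
have [R1 RB RM] : [/\ R 1, forall x y, R x -> R y -> R (x - y) &
    forall x y, R x -> R y -> R (x * y)].
  by apply: pf_values_ring => //; apply: rel_closedN.
have clR := aclosure_closed R.
have entR e : aclosure R (entry e z).
  case: (levP e) => [eS|[c' [Pc' c'0 [h' wh' c'h']]]].
    by apply: sub_aclosure; exists (entry e) => //; apply: pf_gen; exists e.
  have [||Q [cQ c'Q]] := @pf_univariate _ _ (K i)
      (entries (e |: S)) (entries S) (entry e) c' K0 K1.
  - move=> a [p /=]; rewrite finset.in_setU1 => /orP[/eqP->|pS] <-.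
      by right.
    by left; exists p.
  - apply: pf_sub Pc' => //; apply: tower_le => //.
    by apply: leq_trans (leq_maxr _ _); apply: leq_bigmax.
  have Qz0 : Q z != 0.
    apply: contraNneq c'h' => Qz; rewrite c'Q (_ : Q h' = 0) ?horner0 //.
    apply/polyP => j; rewrite coef0.
    apply: (domS1 (fun h => (Q h)`_j) _ _ _ wh') => [|u]; first exact: pf_sub (cQ j).
    by apply: (vanish _ _ (cQ j)); rewrite Qz coef0.
  apply: (rel_closed_root clR Qz0); last by rewrite rootE -c'Q c'0.
  by move=> j; apply: sub_aclosure; exists (fun h => (Q h)`_j).
have clc : aclosure R (c z).
  apply: (pf_eval clR _ _ Pci).
    by move=> a Ka; apply: sub_aclosure; exists (fun=> a) => //; apply: pf_const.
  by move=> _ [e _ <-].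
have cz0 : c z != 0.
  apply: contraNneq ch0 => /(vanish _ _ Pci) cw1.
  have := cw1 (fun j => if (j < size w)%N then 0 else d (j - size w)%N).
  by rewrite -word_glue (word0 (w := w)) // mulmx1 -hd => ->.
have [q [q0 Rq qc]] := algebraic_over_ring R1 RB RM clc cz0.
have /choice[f fP] j : exists f, polyfun (K i) (entries S) f /\ f z = q`_j.
  by have [f Pf fq] := Rq j; exists f.
pose H h := \sum_(j < size q) f j h * c h ^+ j.
have PH : polyfun (K i) (entries [set: _]) H.
  apply: pf_sum => // j _; apply: pf_mul; last exact: pf_exp.
  apply: pf_sub (fP j).1 => // _ [p _ <-]; exists p => //=.
  by rewrite finset.in_setT.
have Hz : H z = 0.
  rewrite -[RHS](rootP qc) horner_coef; apply: eq_bigr => j _.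
  by rewrite (fP j).2.
have f0w u : f 0%N (word w u) = 0.
  have := vanish _ _ PH Hz (fun j => if (j < size w)%N then u j else 0).
  rewrite -word_prefix0 /H.
  have : (0 < size q)%N.
    by rewrite size_poly_gt0; apply: contraNneq q0 => ->; rewrite coef0.
  case: (size q) => // m _; rewrite big_ord_recl cw expr0 mulr1 big1 ?addr0 // => j _.
  by rewrite lift0 expr0n mulr0.
have f0z : f 0%N z = 0.
  apply: (domS (f 0%N)) => //; last by exists w1, (t i).
  by apply: pf_sub (fP 0%N).1.
by move: q0; rewrite -(fP 0%N).2 f0z eqxx.
Qed.

End Words.

(** * A field automorphism with a surjective Lang map *)

Lemma graph_frac_gdom (F : fieldType) (G : set (F * F)) :
  iso_ring G -> gdom G = gcod G -> gdom (graph_frac G) = gcod (graph_frac G).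
Proof.
move=> isoG Gdc; have [_ _ _ G0] := isoG; rewrite eqEsubset; split=> x.
  move=> [_ [[a a'] [[b b'] [Ga Gb b0 [-> _]]]]].
  have [c Gc] : gcod G a by rewrite -Gdc; exists a'.
  have [d Gd] : gcod G b by rewrite -Gdc; exists b'.
  exists (c / d), (c, a), (d, b); split=> //=.
  by rewrite (G0 _ Gd).
move=> [_ [[a a'] [[b b'] [Ga Gb b0 [_ ->]]]]].
have [c Gc] : gdom G a' by rewrite Gdc; exists a.
have [d Gd] : gdom G b' by rewrite Gdc; exists b.
exists (c / d), (a', c), (b', d); split=> //=.
by rewrite -(G0 _ Gb).
Qed.

Lemma iso_field_automorphism (F : fieldType) (G : set (F * F)) :
    iso_field G -> gdom G = setT -> gcod G = setT ->
  exists s s' : {rmorphism F -> F},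
    [/\ cancel s s', cancel s' s & forall x y, G (x, y) -> y = s x].
Proof.
move=> [[G1 GB GM G0] _] domG codG.
have fG x y y' : G (x, y) -> G (x, y') -> y = y'.
  move=> Gy Gy'; apply/eqP; rewrite -subr_eq0.
  by have := G0 _ (GB _ _ Gy Gy'); rewrite /= subrr eqxx => <-.
have iG x x' y : G (x, y) -> G (x', y) -> x = x'.
  move=> Gx Gx'; apply/eqP; rewrite -subr_eq0.
  by have := G0 _ (GB _ _ Gx Gx'); rewrite /= subrr eqxx => ->.
have /choice[f fP] x : exists y, G (x, y) by change (gdom G x); rewrite domG.
have /choice[g gP] y : exists x, G (x, y) by change (gcod G y); rewrite codG.
have fB : zmod_morphism f by move=> x y; apply: fG (fP _) (GB _ _ (fP x) (fP y)).
have fM : monoid_morphism f.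
  by split=> [|x y]; [apply: fG (fP _) G1|apply: fG (fP _) (GM _ _ (fP x) (fP y))].
have gB : zmod_morphism g by move=> x y; apply: iG (gP _) (GB _ _ (gP x) (gP y)).
have gM : monoid_morphism g.
  by split=> [|x y]; [apply: iG (gP _) G1|apply: iG (gP _) (GM _ _ (gP x) (gP y))].
pose f' : {rmorphism F -> F} := HB.pack f
  (GRing.isZmodMorphism.Build F F f fB) (GRing.isMonoidMorphism.Build F F f fM).
pose g' : {rmorphism F -> F} := HB.pack g
  (GRing.isZmodMorphism.Build F F g gB) (GRing.isMonoidMorphism.Build F F g gM).
exists f', g'; split=> [x|x|x y Gxy] /=.
- exact: iG (gP _) (fP x).
- exact: fG (fP _) (gP x).
- exact: fG Gxy (fP x).
Qed.

Section Lang.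
Variables (F : closedFieldType) (N : nat) (V : Type) (P : V -> F -> 'M[F]_N).
Local Notation Z := (range (fun a : int => a%:~R : F)).
Local Notation M := 'M[F]_N.

Hypothesis P0 : forall v, P v 0 = 1%:M.
Hypothesis PD : forall v s t, P v (s + t) = P v s *m P v t.
Hypothesis P_poly : forall v k l, polyfun Z [set id] (fun t => P v t k l).
Hypothesis P_map :
  forall (s : {rmorphism F -> F}) v t, map_mx s (P v t) = P v (s t).

Variables (K : nat -> set F) (t : nat -> M * nat -> F).
Hypothesis Kr : forall i, rel_closed (K i).
Hypothesis KS : forall i, K i `<=` K i.+1.
Hypothesis KT : forall x, exists i, K i x.
Hypothesis gen_t : forall i, generic (K i) (t i).
Hypothesis Kt : forall i x, K i.+1 (t i x).

Definition over (L : set F) (g : M) := forall k l, L (g k l).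

Definition family (zeta : M -> M) := forall g, words P (zeta g).

Definition family_entry (q : M * ('I_N * 'I_N)) (zeta : M -> M) : F :=
  zeta q.1 q.2.1 q.2.2.

Local Notation family_entries := [set family_entry q | q in setT].

(** With [s'] inverse to [s], this is the polynomial obtained from [f] by applying
    [s] to its coefficients, evaluated at the family [a g *m zeta g]. The formula
    avoids naming the coefficients of [f]. *)
Definition twist (s s' : F -> F) (a : M -> M) (f : (M -> M) -> F)
    (zeta : M -> M) : F :=
  s (f (fun g => map_mx s' (a g *m zeta g))).

Lemma twist_poly i (s : {rmorphism F -> F}) s' (a : M -> M) f :
    cancel s' s -> (forall x, K i x -> K i (s x)) ->
    (forall g, over (K i) (a g)) ->
  polyfun (K i) family_entries f -> polyfun (K i) family_entries (twist s s' a f).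
Proof.
move=> s'K sK aK; elim=> [c Kc|_ [[g [k l]] _ <-]|
  {}f f' _ Pf _ Pf'|{}f f' _ Pf _ Pf'].
- by apply: pf_const; apply: sK.
- rewrite (_ : twist _ _ _ _ = fun zeta : M -> M =>
      \sum_j a g k j * family_entry (g, (j, l)) zeta); last first.
    by apply/funext => zeta; rewrite /twist /family_entry /= !mxE s'K.
  apply: pf_sum => [|j _]; first exact: (rel_closed0 (Kr i)).
  apply: pf_mul; first by apply: pf_const; apply: aK.
  by apply: pf_gen; exists (g, (j, l)).
- rewrite (_ : twist _ _ _ _ =
      fun zeta => twist s s' a f zeta + twist s s' a f' zeta).
    exact: pf_add.
  by apply/funext => zeta; rewrite /twist rmorphD.
- rewrite (_ : twist _ _ _ _ =
      fun zeta => twist s s' a f zeta * twist s s' a f' zeta).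
    exact: pf_mul.
  by apply/funext => zeta; rewrite /twist rmorphM.
Qed.

Section Step.
Variables (W : seq V) (i : nat).
Hypothesis domW : dominant P [set: _] W.

Definition gen_family (g : M) : M := word P W (fun j => t i (g, j)).
Local Notation z := gen_family.

Lemma gen_family_over g : over (K i.+1) (z g).
Proof.
move=> k l.
apply: (@pf_eval F (nat -> F) Z _ (@coords F nat) _ (fun u => word P W u k l)).
- exact: Kr.
- by move=> _ [a _ <-]; apply: rel_closed_int.
- by move=> _ [j _ <-]; apply: Kt.
exact: word_poly.
Qed.

(** Genericity of the parameters gives the families of values of the word [W]. A
    family of arbitrary group elements is reached by changing one member at a
    time, each change being justified by the dominance of [W]; only the finitely
    many members on which [f] depends matter. *)
Lemma gen_family_vanish f : polyfun (K i) family_entries f -> f z = 0 ->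
  forall zeta, family zeta -> f zeta = 0.
Proof.
move=> Pf fz.
have Pphi : polyfun (K i) (@coords F (M * nat)%type)
    (fun u => f (fun g => word P W (fun j => u (g, j)))).
  apply: pf_comp Pf => // _ [[g [k l]] _ <-].
  apply: (@pf_comp F (nat -> F) (M * nat -> F) (fun u j => u (g, j)) Z _
            (@coords F nat) _ (fun u => word P W u k l)); last exact: word_poly.
    by move=> _ [b _ <-]; apply: rel_closed_int.
  by move=> _ [j _ <-]; apply: pf_gen; exists (g, j).
have fphi := generic_vanish (rel_closed0 (Kr i)) (rel_closed1 (Kr i))
  (@gen_t i) Pphi fz.
have [L [_ _ PfL]] := pf_finite_uniq Pf.
have fW (l : seq M) zeta : family zeta ->
    (forall g, g \notin l -> exists u, zeta g = word P W u) -> f zeta = 0.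
  elim: l zeta => [|g l IH] zeta fam zW.
    have /choice[u zu] g : exists u, zeta g = word P W u by apply: zW.
    have -> : zeta = fun g => word P W (fun j => u g j) by apply/funext => g.
    exact: (fphi (fun x => u x.1 x.2)).
  pose upd h g' := if g' == g then h else zeta g'.
  have := domW (c := fun h => f (upd h)).
  have -> : f zeta = f (upd (zeta g)).
    by congr f; apply/funext => g'; rewrite /upd; case: eqP => [->|].
  apply=> //.
    apply: pf_comp Pf => // _ [[g' [k m]] _ <-]; rewrite /family_entry /upd /=.
    case: (g' == g); last exact: pf_const.
    by apply: pf_gen; exists (k, m) => //=; rewrite finset.in_setT.
  move=> u; apply: IH => [g'|g' g'l]; rewrite /upd; case: eqP => [_|/eqP g'g].
  - by exists W, u.
  - exact: fam.
  - by exists u.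
  - by apply: zW; rewrite inE negb_or g'g.
move=> zeta fam.
have <- : f (fun g => if g \in map fst L then zeta g else 1%:M) = f zeta.
  apply: pf_agree PfL => _ [q /= qL <-]; rewrite /family_entry ifT //.
  exact: map_f.
apply: (fW (map fst L)) => [g|g /negPf->].
  by case: ifP => _; [apply: fam|apply: words1].
by exists (fun=> 0); rewrite word0.
Qed.

Variables s s' : {rmorphism F -> F}.
Hypotheses (sK : cancel s s') (s'K : cancel s' s).
Hypothesis sKi : forall x, K i x -> K i (s x).
Hypothesis s'Ki : forall x, K i x -> K i (s' x).

(** Sending [z g] to [g *m z g] for all [g] over [K i] is compatible with [s] on
    [K i]: by [gen_family_vanish], a polynomial vanishing at the family [z]
    vanishes at every family, and so does its twist. The fields on both sides
    coincide because twisting by inverses undoes [twf]; the isomorphism thus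
    extends to an automorphism of [K i.+1], then of [F]. *)
Lemma extend_step : exists s1 s1' : {rmorphism F -> F},
  [/\ cancel s1 s1', cancel s1' s1,
      forall x, K i.+1 x -> K i.+1 (s1 x) /\ K i.+1 (s1' x),
      forall x, K i x -> s1 x = s x &
      forall g h, words P g -> words P h -> h *m g = 1%:M ->
        over (K i) g -> over (K i) h ->
        exists x, [/\ words P x, over (K i.+1) x & map_mx s1 x = g *m x]].
Proof.
pose task g h :=
  [/\ words P g, words P h, h *m g = 1%:M, over (K i) g & over (K i) h].
have over1 : over (K i) 1%:M.
  move=> k l; rewrite mxE; case: (k == l); first exact: (rel_closed1 (Kr i)).
  exact: (rel_closed0 (Kr i)).
(* ab pairs a matrix with its inverse; other matrices than those to be treated
   get the trivial pair, so that all families may be twisted uniformly. *)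
have /choice[ab abP] g : exists ab : M * M, task ab.1 ab.2 /\
    ((exists h, task g h) -> ab.1 = g).
  have [[h gh]|ng] := pselect (exists h, task g h); first by exists (g, h).
  by exists (1%:M, 1%:M); split=> //; split; rewrite ?mulmx1 //; apply: words1.
pose a g := (ab g).1; pose b g := (ab g).2.
have wa g : words P (a g) by have [[]] := abP g.
have wb g : words P (b g) by have [[]] := abP g.
have ba g : b g *m a g = 1%:M by have [[]] := abP g.
have Ka g : over (K i) (a g) by have [[]] := abP g.
have Kb g : over (K i) (b g) by have [[]] := abP g.
have famz : family z by move=> g; exists W, (fun j => t i (g, j)).
pose Pt := polyfun (K i) family_entries.
pose twf := twist s s' a.
have Ptw f : Pt f -> Pt (twf f) by apply: twist_poly.
pose untwf := twist s' s (fun g => map_mx s' (b g)).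
have Putw f : Pt f -> Pt (untwf f).
  by apply: twist_poly => // g k l; rewrite mxE; apply: s'Ki; apply: Kb.
have mapK (A : M) : map_mx s (map_mx s' A) = A.
  by apply/matrixP => k l; rewrite !mxE s'K.
have mapK' (A : M) : map_mx s' (map_mx s A) = A.
  by apply/matrixP => k l; rewrite !mxE sK.
have twK f : twf (untwf f) = f.
  apply/funext => zeta; rewrite /twf /untwf /twist s'K; congr f; apply/funext => g.
  by rewrite map_mxM !mapK mulmxA ba mul1mx.
pose G0 := [set p : F * F | exists2 f, Pt f & p = (f z, twf f z)].
have famtw zeta : family zeta -> family (fun g => map_mx s' (a g *m zeta g)).
  by move=> fam g; apply: words_map (P_map s') _; apply: wordsM.
have isoG0 : iso_ring G0.
  split.
  - exists (fun=> 1); first by apply: pf_const; apply: (rel_closed1 (Kr i)).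
    by rewrite /twf /twist rmorph1.
  - move=> _ _ [f Pf ->] [g Pg ->]; exists (fun u => f u + (-1) * g u).
      apply/pf_add/pf_mul => //; apply: pf_const; apply: (rel_closedN (Kr i)).
      exact: (rel_closed1 (Kr i)).
    by rewrite /twf /twist rmorphD rmorphM rmorphN1 !mulN1r.
  - move=> _ _ [f Pf ->] [g Pg ->]; exists (fun u => f u * g u); first exact: pf_mul.
    by rewrite /twf /twist rmorphM.
  move=> _ [f Pf ->] /=; apply/eqP/eqP => [fz|twfz].
    by rewrite /twf /twist (gen_family_vanish Pf fz) ?rmorph0 //; apply: famtw.
  have := gen_family_vanish (Ptw _ Pf) twfz (zeta := fun g => b g *m map_mx s (z g)).
  rewrite /twf /twist => tw0; apply/eqP; rewrite -(fmorph_eq0 s); apply/eqP.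
  rewrite -[RHS]tw0; last first.
    by move=> g; apply: wordsM (wb g) (words_map (P_map s) (famz g)).
  congr (s (f _)); apply/funext => g.
  by rewrite mulmxA (mulmx1C (ba g)) mul1mx mapK'.
have G0dc : gdom G0 = gcod G0.
  rewrite eqEsubset; split=> x [y [f Pf [xE yE]]].
    exists (untwf f z), (untwf f); first exact: Putw.
    by rewrite twK xE.
  by rewrite yE; exists (twf (twf f) z), (twf f) => //; apply: Ptw.
pose G1 := graph_frac G0.
have isoG1 : iso_field G1 by apply: graph_frac_iso_field.
have KPt f : Pt f -> K i.+1 (f z).
  move=> Pf; apply: (pf_eval (Kr i.+1) (@KS i) _ Pf).
  by move=> _ [[g [k l]] _ <-]; apply: gen_family_over.
have G1K : G1 `<=` K i.+1 `*` K i.+1.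
  move=> _ [_ [_ [[f Pf ->] [g Pg ->] _ ->]]].
  split; apply: (rel_closedM (Kr _)); do ?apply: (rel_closedV (Kr _));
  by apply: KPt => //; apply: Ptw.
have [G2 [isoG2 G12 G2dom G2cod]] := extend_automorphism (Kr i.+1) isoG1 G1K
  (graph_frac_gdom isoG0 G0dc).
have [||G3 [isoG3 G23 G3dom G3cod]] :=
    extend_automorphism (@rel_closedT F) isoG2; first by [].
  by rewrite G2dom G2cod.
have [s1 [s1' [s1K s1'K s1P]]] := iso_field_automorphism isoG3 G3dom G3cod.
have s1G0 x y : G0 (x, y) -> s1 x = y.
  by move=> Gxy; apply/esym/s1P/G23/G12; apply: sub_graph_frac.
exists s1, s1'; split=> //.
- move=> x Kx; split.
    have [y Gxy] : gdom G2 x by rewrite G2dom.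
    by rewrite -(s1P _ _ (G23 _ Gxy)) -G2cod; exists x.
  have [y Gyx] : gcod G2 x by rewrite G2cod.
  by rewrite (s1P _ _ (G23 _ Gyx)) s1K -G2dom; exists x.
- by move=> x Kx; apply: s1G0; exists (fun=> x) => //; apply: pf_const.
move=> g h wg wh hg Kg Kh; exists (z g); split; [exact: famz|exact: gen_family_over|].
have ag : a g = g by have [_] := abP g; apply; exists h.
apply/matrixP => k l; rewrite mxE; apply: s1G0.
exists (family_entry (g, (k, l))); first by apply: pf_gen; exists (g, (k, l)).
by congr pair; rewrite /twf /twist /family_entry /= !mxE s'K ag.
Qed.

End Step.

Lemma over_level (g : M) : exists i, over (K i) g.
Proof.
have /choice[h hP] (p : 'I_N * 'I_N) : exists i, K i (g p.1 p.2) by apply: KT.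
exists (\max_p h p)%N => k l; apply: tower_le (hP (k, l)) => //.
exact: (leq_bigmax (k, l)).
Qed.

(** The automorphisms given by [extend_step] agree on larger and larger [K i], and
    glue together. A matrix and its inverse both have entries in some [K i], which
    is where its equation gets solved. *)
Lemma generic_automorphism : exists s s' : {rmorphism F -> F},
  [/\ cancel s s', cancel s' s &
      forall g, words P g -> exists2 x, words P x & map_mx s x = g *m x].
Proof.
have gen1 i : generic (K i) (fun j => t i (1%:M, j)).
  by apply: (@generic_reindex _ _ _ _ (fun j => (1%:M, j))) (@gen_t i) => j k [].
have [W domW] := dominant_word P0 P_poly Kr KS KT gen1.
pose RM := {rmorphism F -> F}.
pose good i (p : RM * RM) := [/\ cancel p.1 p.2, cancel p.2 p.1 &
  forall x, K i x -> K i (p.1 x) /\ K i (p.2 x)].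
pose next i (p q : RM * RM) := [/\ good i.+1 q, forall x, K i x -> q.1 x = p.1 x &
  forall g h, words P g -> words P h -> h *m g = 1%:M ->
    over (K i) g -> over (K i) h ->
    exists x, [/\ words P x, over (K i.+1) x & map_mx q.1 x = g *m x]].
have /choice[nx nxP] (ip : nat * (RM * RM)) :
    exists q, good ip.1 ip.2 -> next ip.1 ip.2 q.
  case: ip => i [s s'] /=.
  have [[/= sK s'K sKi]|ng] := pselect (good i (s, s')); last by exists (s, s').
  have [||s1 [s1' [s1K s1'K s1Ki s1s s1x]]] := extend_step domW sK s'K (i := i).
  - by move=> x /sKi[].
  - by move=> x /sKi[].
  by exists (s1, s1').
pose id0 : RM := @idfun F.
pose c := fix c i : RM * RM := if i is j.+1 then nx (j, c j) else (id0, id0).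
have goodc i : good i (c i).
  elim: i => [|i IH]; first by split.
  by have [] := nxP (i, c i) IH.
have nextc i : next i (c i) (c i.+1) by apply: (nxP (i, c i)).
have c1 i j x : (i <= j)%N -> K i x -> (c j).1 x = (c i).1 x.
  move=> /subnK<- Kx; elim: (j - i)%N => // n IH.
  rewrite addSn; have [_ -> //] := nextc (n + i)%N.
  by apply: tower_le Kx => //; apply: leq_addl.
have c2 i j x : (i <= j)%N -> K i x -> (c j).2 x = (c i).2 x.
  move=> ij Kx; have [_ cK Kc] := goodc i; have [cK' _ _] := goodc j.
  by rewrite -[in LHS](cK x) -(c1 i j) // ?cK' //; case: (Kc x Kx).
have /choice[lev levP] := KT.
pose f1 x := (c (lev x)).1 x; pose f2 x := (c (lev x)).2 x.
have f1E i x : K i x -> f1 x = (c i).1 x.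
  move=> Kx; rewrite -(c1 i (maxn i (lev x))) ?leq_maxl //.
  by rewrite (c1 (lev x)) ?leq_maxr.
have f2E i x : K i x -> f2 x = (c i).2 x.
  move=> Kx; rewrite -(c2 i (maxn i (lev x))) ?leq_maxl //.
  by rewrite (c2 (lev x)) ?leq_maxr.
have common x y : exists i, K i x /\ K i y.
  exists (maxn (lev x) (lev y)).
  by split; apply: tower_le (levP _) => //; rewrite (leq_maxl, leq_maxr).
have f1B : zmod_morphism f1.
  move=> x y; have [i [Kx Ky]] := common x y.
  by rewrite !(f1E i) ?rmorphB //; apply: (rel_closedB (Kr i)).
have f2B : zmod_morphism f2.
  move=> x y; have [i [Kx Ky]] := common x y.
  by rewrite !(f2E i) ?rmorphB //; apply: (rel_closedB (Kr i)).
have f1M : monoid_morphism f1.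
  split=> [|x y]; first by rewrite /f1 rmorph1.
  have [i [Kx Ky]] := common x y.
  by rewrite !(f1E i) ?rmorphM //; apply: (rel_closedM (Kr i)).
have f2M : monoid_morphism f2.
  split=> [|x y]; first by rewrite /f2 rmorph1.
  have [i [Kx Ky]] := common x y.
  by rewrite !(f2E i) ?rmorphM //; apply: (rel_closedM (Kr i)).
pose s : {rmorphism F -> F} := HB.pack f1
  (GRing.isZmodMorphism.Build F F f1 f1B) (GRing.isMonoidMorphism.Build F F f1 f1M).
pose s' : {rmorphism F -> F} := HB.pack f2
  (GRing.isZmodMorphism.Build F F f2 f2B) (GRing.isMonoidMorphism.Build F F f2 f2M).
exists s, s'; split=> [x|x|g wg] /=.
- have [i Kx] := KT x; have [cK _ /(_ _ Kx)[Kcx _]] := goodc i.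
  by rewrite (f1E i) // (f2E i).
- have [i Kx] := KT x; have [_ cK /(_ _ Kx)[_ Kcx]] := goodc i.
  by rewrite (f2E i) // (f1E i).
have [h wh hg] := words_inv P0 PD wg.
have [i Kg] := over_level g; have [j Kh] := over_level h.
have [_ _ /(_ g h wg wh hg)] := nextc (maxn i j).
case=> [k l|k l|x [wx Kx cx]].
- by apply: tower_le (Kg k l) => //; apply: leq_maxl.
- by apply: tower_le (Kh k l) => //; apply: leq_maxr.
exists x => //; rewrite -cx; apply/matrixP => k l; rewrite !mxE.
by apply: f1E; apply: Kx.
Qed.

End Lang.

(** * Exponentials of nilpotent matrices *)

Lemma commutator_power (R : comNzRingType) (N : nat) (H X : 'M[R]_N) (d : R) k :
  H *m X - X *m H = d *: X -> H *m X ^+ k - X ^+ k *m H = (d *+ k) *: X ^+ k.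
Proof.
move=> HX; elim: k => [|k IH].
  by rewrite expr0 mulr0n scale0r mulmx1 mul1mx subrr.
rewrite exprS -mulmxE mulmxA (_ : H *m X = d *: X + X *m H); last first.
  by rewrite -HX subrK.
rewrite mulmxDl -!mulmxA (_ : H *m X ^+ k = (d *+ k) *: X ^+ k + X ^+ k *m H).
  by rewrite mulmxDr addrA addrK -scalemxAl -scalemxAr -scalerDl mulrS.
by rewrite -IH subrK.
Qed.

(** The nonzero powers of [X] are eigenvectors of [ad H] for the distinct eigenvalues
    [d *+ k], so some power vanishes. Then 0 is the only eigenvalue of [X], and the
    theorem of Cayley and Hamilton gives the exponent. *)
Lemma commutator_nilpotent (C : numClosedFieldType) (N : nat)
    (H X : 'M[C]_N) (d : C) :
  d != 0 -> H *m X - X *m H = d *: X -> X ^+ N = 0.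
Proof.
move=> d0 HX.
have [k Xk] : exists k, X ^+ k = 0.
  apply: contrapT => /forallNP Xn0.
  pose ad := lin_mx (mulmx H) - lin_mx (mulmxr H).
  pose rs := [seq d *+ k | k <- iota 0 (size (char_poly ad))].
  have : (size rs < size (char_poly ad))%N.
    apply: max_poly_roots; first exact/monic_neq0/char_poly_monic.
      apply/allP => _ /mapP[k _ ->]; rewrite -eigenvalue_root_char.
      apply/eigenvalueP; exists (mxvec (X ^+ k)).
        rewrite mulmxBr !mul_vec_lin /= -linearB -linearZ /=; congr mxvec.
        exact: commutator_power.
      by rewrite mxvec_eq0; apply/eqP/Xn0.
    rewrite map_inj_uniq ?iota_uniq // => i j /eqP.
    rewrite -[d *+ i]mulr_natr -[d *+ j]mulr_natr (inj_eq (mulfI d0)).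
    by rewrite eqr_nat => /eqP.
  by rewrite size_map size_iota ltnn.
case: N H X HX Xk => [|n] H X HX Xk; first by apply: flatmx0.
have [rs rsP] := closed_field_poly_normal (char_poly X).
rewrite (monicP (char_poly_monic X)) scale1r in rsP.
have rs0 z : z \in rs -> z = 0.
  move=> zrs; have : root (char_poly X) z by rewrite rsP root_prod_XsubC.
  rewrite -eigenvalue_root_char => /eigenvalueP[v vX v0].
  have vXk j : v *m X ^+ j = z ^+ j *: v.
    elim: j => [|j IH]; first by rewrite !expr0 mulmx1 scale1r.
    by rewrite exprSr -mulmxE mulmxA IH -scalemxAl vX scalerA -exprSr.
  have := vXk k; rewrite Xk mulmx0 => /esym/eqP.
  by rewrite scaler_eq0 (negPf v0) orbF expf_eq0 => /andP[_ /eqP].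
have cX : char_poly X = 'X^(n.+1).
  rewrite rsP; have := size_char_poly X; rewrite rsP size_prod_XsubC => -[<-].
  elim: rs rs0 {rsP} => [|z rs IH] rs0; first by rewrite big_nil.
  rewrite big_cons IH => [|y yrs]; last by apply: rs0; rewrite inE yrs orbT.
  by rewrite (rs0 z) ?mem_head // subr0 exprS.
by have := Cayley_Hamilton X; rewrite cX rmorphXn /= horner_mx_X.
Qed.

Lemma sum_convolution (W : nmodType) (N : nat) (h : nat -> nat -> W) :
  (forall i j, (N <= i + j)%N -> h i j = 0) ->
  \sum_(i < N) \sum_(j < N) h i j = \sum_(k < N) \sum_(i < k.+1) h i (k - i)%N.
Proof.
move=> h0.
have inner (i : 'I_N) :
    \sum_(j < N) h i j = \sum_(k < N | (i <= k)%N) h i (k - i)%N.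
  rewrite -(big_geq_mkord i N xpredT (fun k => h i (k - i)%N)).
  rewrite -{2}[i : nat]add0n big_addn big_mkord.
  rewrite (big_ord_widen N (fun j => h i (j + i - i)%N)) ?leq_subr //.
  rewrite big_mkcond [RHS]big_mkcond; apply: eq_bigr => j _ /=.
  by rewrite addnK; case: ltnP => //; rewrite leq_subLR; apply: h0.
rewrite (eq_bigr _ (fun i _ => inner i)) (exchange_big_dep predT) //=.
apply: eq_bigr => k _.
by rewrite (big_ord_widen N (fun i => h i (k - i)%N)).
Qed.

Section DividedPowers.
Variables (F : fieldType) (N : nat) (A : nat -> 'M[int]_N).
Hypothesis A0 : A 0%N = 1%:M.
Hypothesis AN : forall k, (N <= k)%N -> A k = 0.
Hypothesis AM : forall i j, A i *m A j = 'C(i + j, i)%:R *: A (i + j)%N.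
Local Notation Af k := (map_mx (intr : int -> F) (A k)).

Definition divexp (t : F) : 'M[F]_N := \sum_(k < N) t ^+ k *: Af k.

Lemma divexp0 : divexp 0 = 1%:M.
Proof.
rewrite /divexp; case: N A A0 => [|n] B B0; first by rewrite big_ord0 [RHS]flatmx0.
rewrite big_ord_recl /= expr0 scale1r B0 map_mx1 big1 ?addr0 // => i _.
by rewrite expr0n scale0r.
Qed.

Lemma divexpD s t : divexp (s + t) = divexp s *m divexp t.
Proof.
rewrite /divexp mulmx_suml.
under [RHS]eq_bigr do rewrite mulmx_sumr.
pose h i j := (s ^+ i * t ^+ j) *: (Af i *m Af j).
have hE i j : h i j = (s ^+ i * t ^+ j *+ 'C(i + j, i)) *: Af (i + j)%N.
  rewrite /h -map_mxM AM map_mxZ /= scalerA rmorph_nat mulr_natr.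
  by [].
rewrite [RHS](_ : _ = \sum_(i < N) \sum_(j < N) h i j); last first.
  apply: eq_bigr => i _; apply: eq_bigr => j _.
  by rewrite /h -scalemxAl -scalemxAr scalerA.
rewrite sum_convolution => [|i j ij]; last by rewrite hE AN // map_mx0 scaler0.
apply: eq_bigr => k _; rewrite addrC exprDn scaler_suml; apply: eq_bigr => i _.
have ik : (i <= k)%N by rewrite -ltnS.
by rewrite hE subnKC // [t ^+ _ * _]mulrC.
Qed.

Lemma divexp_map (s : {rmorphism F -> F}) t : map_mx s (divexp t) = divexp (s t).
Proof.
apply/matrixP => k l; rewrite /divexp mxE !summxE rmorph_sum; apply: eq_bigr => j _.
by rewrite !mxE rmorphM rmorphXn rmorph_int.
Qed.

End DividedPowers.

(** * The automorphism of the Chevalley group *)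

(** For the element h of the Cartan subalgebra corresponding to the root v itself,
    [h, x_v] = (v, v) x_v, and (v, v) is a nonzero sum of squares of integers:
    [commutator_nilpotent] applies. *)
Lemma divpow_relations (R : realType) (n : nat) (Phi : pred 'rV[int]_n)
    (D : chevalley_datum R Phi) (v : 'rV[int]_n) (A := cd_divpow D v) : Phi v ->
  [/\ A 0%N = 1%:M, forall k, (cd_dim D <= k)%N -> A k = 0 &
      forall i j, A i *m A j = 'C(i + j, i)%:R *: A (i + j)%N].
Proof.
move=> Phiv; set N := cd_dim D; pose C := complex R : numClosedFieldType.
pose X : 'M[C]_N := cd_rep D (cd_rootvec D v).
have AX k : map_mx (intr : int -> C) (A k) = (k`!%:R)^-1 *: X ^+ k.
  exact: cd_admissible.
have inj (B B' : 'M[int]_N) :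
    map_mx (intr : int -> C) B = map_mx intr B' -> B = B'.
  move=> /matrixP BB'; apply/matrixP => i j.
  by have := BB' i j; rewrite !mxE => /intr_inj.
have XN : X ^+ N = 0.
  have [_ _ /(_ (map_mx intr v)) rootv] := cd_roots D.
  have [v0 _] : is_root (cd_cartan D) (map_mx intr v) by apply/rootv; exists v.
  have [/(_ v Phiv) rootX _ _] := cd_chevalley D.
  have [repB _] := cd_faithful D.
  pose a : 'rV[C]_n := map_mx intr v.
  apply: (@commutator_nilpotent C N (cd_rep D (cd_cartan D a)) X (dot a a)).
    rewrite /dot (_ : \sum_i _ = (\sum_i v 0 i ^+ 2)%:~R); last first.
      by rewrite rmorph_sum; apply: eq_bigr => i _; rewrite !mxE -rmorphM expr2.
    rewrite intr_eq0 psumr_eq0 => [|i _]; last exact: sqr_ge0.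
    apply: contraNN v0 => /allP v0; apply/eqP/rowP => i; rewrite !mxE.
    by have := v0 i (mem_index_enum i); rewrite sqrf_eq0 => /eqP ->.
  by rewrite -repB rootX linearZ.
split.
- by apply: inj; rewrite AX fact0 invr1 scale1r map_mx1 expr0.
- move=> k Nk; apply: inj; rewrite AX map_mx0 -(subnKC Nk) exprD XN mul0r.
  exact: scaler0.
move=> i j; apply: inj; rewrite map_mxM map_mxZ /= !AX -scalemxAl -scalemxAr.
rewrite !scalerA mulmxE -exprD; congr (_ *: _).
rewrite rmorph_nat -(bin_fact (leq_addr j i)) addKn !natrM.
have f0 k : k`!%:R != 0 :> C by rewrite pnatr_eq0 -lt0n fact_gt0.
have b0 : 'C(i + j, i)%:R != 0 :> C by rewrite pnatr_eq0 -lt0n bin_gt0 leq_addr.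
by field; rewrite !f0 b0.
Qed.

Lemma divexp_poly (F : fieldType) N (A : nat -> 'M[int]_N) k l :
  polyfun (range (fun a : int => a%:~R : F)) [set id] (fun t => divexp A t k l).
Proof.
rewrite (_ : (fun t => divexp A t k l) =
    fun t => \sum_(j < N) t ^+ j * (A j k l)%:~R); last first.
  apply/funext => t; rewrite /divexp summxE.
  by apply: eq_bigr => j _; rewrite !mxE.
apply: pf_sum => [|j _]; first by exists 0.
apply: pf_mul; last by apply: pf_const; exists (A j k l).
by apply: pf_exp; [exists 1|apply: pf_gen].
Qed.

Section GroupAutomorphism.
Variables (R : realType) (n : nat) (Phi : pred 'rV[int]_n).
Variables (D : chevalley_datum R Phi) (F : fieldType).
Local Notation N := (cd_dim D).
Local Notation G := (chevalley_group D F).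

Definition root_curve (v : {v | Phi v}) (t : F) : 'M[F]_N :=
  root_element D (sval v) t.

Lemma root_curve0 v : root_curve v 0 = 1%:M.
Proof. by have [A0 _ _] := divpow_relations D (svalP v); apply: divexp0. Qed.

Lemma root_curveD v s t : root_curve v (s + t) = root_curve v s *m root_curve v t.
Proof. by have [A0 AN AM] := divpow_relations D (svalP v); apply: divexpD. Qed.

Lemma root_curve_map (s : {rmorphism F -> F}) v t :
  map_mx s (root_curve v t) = root_curve v (s t).
Proof. exact: divexp_map. Qed.

Local Notation curve_words := (words root_curve).

Lemma root_curveV v t : root_curve v t \in unitmx.
Proof.
have : root_curve v (- t) *m root_curve v t = 1%:M.
  by rewrite -root_curveD addNr root_curve0.
by case/mulmx1_unit.
Qed.

Lemma generated_words (x : G) : curve_words (GLmx (sg_val x)).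
Proof.
pose H : {pred GL F N} := fun g => `[< curve_words (GLmx g) >].
have clH : group_closed H.
  split=> [|g h /asboolP wg /asboolP wh]; first exact/asboolP/words1.
  apply/asboolP; have [k wk kh] := words_inv root_curve0 root_curveD wh.
  suff -> : GLmx (g / h)%g = g *m k by apply: wordsM.
  congr (_ *m _); rewrite /= -[LHS]mul1mx -kh -mulmxA mulmxV ?mulmx1 //.
  exact: GLmx_unit.
have /asboolP/(_ H clH) := sg_valP x; move=> Hx; apply/asboolP; apply: Hx.
move=> g [v Phiv [t gt]]; apply/asboolP; rewrite gt.
exact: (@words_letter _ _ _ root_curve (exist _ v Phiv) t).
Qed.

Lemma words_generated g : curve_words g -> exists x : G, GLmx (sg_val x) = g.
Proof.
move=> [w [u ->]]; elim: w => [|v w [x xw]] /=; first by exists 1%g.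
pose y : GL F N := MkGL (root_curveV v (u (size w))).
have yG : y \in generated (@chevalley_generator R n Phi D F).
  have gy : @chevalley_generator R n Phi D F y.
    by exists (sval v); [exact: (svalP v)|exists (u (size w))].
  by apply/asboolP => H cH /(_ y gy).
by exists (SubgroupGen yG * x)%g; rewrite /= xw.
Qed.

Section FieldAutomorphism.
Variable s : {rmorphism F -> F}.

Fact group_map_subproof (x : G) :
  exists y : G, GLmx (sg_val y) = map_mx s (GLmx (sg_val x)).
Proof.
exact/words_generated/(words_map (@root_curve_map s))/generated_words.
Qed.

Definition group_map (x : G) : G := sval (cid (group_map_subproof x)).

Lemma group_mapE x : GLmx (sg_val (group_map x)) = map_mx s (GLmx (sg_val x)).
Proof. exact: svalP (cid (group_map_subproof x)). Qed.

Lemma GLmx_inj : injective (fun x : G => GLmx (sg_val x)).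
Proof. by move=> x y /val_inj/val_inj. Qed.

Lemma group_mapM : {morph group_map : x y / (x * y)%g}.
Proof. by move=> x y; apply: GLmx_inj; rewrite /= !group_mapE map_mxM. Qed.

Lemma group_mapV : {morph group_map : x / (x^-1)%g}.
Proof.
move=> x; apply: (@mulIg _ (group_map x)); rewrite -group_mapM !mulVg.
by apply: GLmx_inj; rewrite /= group_mapE map_mx1.
Qed.

End FieldAutomorphism.

Lemma group_mapK (s s' : {rmorphism F -> F}) :
  cancel s s' -> cancel (group_map s) (group_map s').
Proof.
move=> sK x; apply: GLmx_inj; rewrite /= !group_mapE.
by apply/matrixP => i j; rewrite !mxE sK.
Qed.

(** If x = a psi(a)^-1 and y = b psi(b)^-1, then x and y are twisted conjugate by
    a b^-1. *)
Lemma lang_automorphism (s s' : {rmorphism F -> F}) :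
    cancel s s' -> cancel s' s ->
    (forall g, curve_words g -> exists2 x, curve_words x & map_mx s x = g *m x) ->
  exists psi : automorphism G, forall x y, twisted_conj psi x y.
Proof.
move=> sK s'K lang.
pose f : {multiplicative G -> G} := HB.pack (group_map s)
  (isMultiplicative.Build G G (group_map s) (group_mapM s)).
have f_bij : bijective f by exists (group_map s'); apply: group_mapK.
exists (Automorphism f_bij).
have conj1 x : exists z : G, (x = z * (f z)^-1)%g.
  have [_ /words_generated[z <-] sz] := lang _ (generated_words x^-1%g).
  exists z; have -> : (f z = x^-1 * z)%g.
    by apply: GLmx_inj; rewrite /= group_mapE sz.
  by rewrite invgM invgK mulgA mulgV mul1g.
move=> x y; have [a ->] := conj1 x; have [b ->] := conj1 y.
exists (a * b^-1)%g; rewrite /= group_mapM group_mapV invgM invgK !mulgA.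
by rewrite mulgVK mulgVK.
Qed.

End GroupAutomorphism.

Lemma reidemeister_lt_pinfty (G : groupType) (psi : automorphism G) :
  (forall x y, twisted_conj psi x y) -> (reidemeister psi < +oo)%E.
Proof.
move=> conj; rewrite /reidemeister ifT ?ltry //; apply/asboolP.
apply: (@sub_finite_set _ _ [set setT]); last exact: finite_set1.
by move=> _ [y ->]; rewrite /= eqEsubset; split=> x _ /=; last exact: conj.
Qed.

Theorem theorem7 (R : realType) (F : closedFieldType)
    (F_char0 : [pchar F] =i pred0) (F_trdeg : infinite_trdeg F)
    (ty : BCD_type) (n : nat) (n_min : (BCD_min_rank ty <= n)%N)
    (D : chevalley_datum R (@BCD_roots n ty)) :
  ~ Rinfty_property (chevalley_group D F) /\
  exists psi : automorphism (chevalley_group D F),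
    (reidemeister psi < +oo)%E.
Proof.
suff [psi psi_fin] : exists psi : automorphism (chevalley_group D F),
    (reidemeister psi < +oo)%E.
  split; last by exists psi.
  by move=> /(_ psi) psi_oo; rewrite psi_oo ltxx in psi_fin.
have [K [t [Kr KS KT gen_t Kt]]] := generic_tower F_char0 (cd_dim D) F_trdeg.
have [s [s' [sK s'K lang]]] := generic_automorphism (@root_curve0 R n _ D F)
  (@root_curveD R n _ D F) (fun v => @divexp_poly F _ (cd_divpow D (sval v)))
  (@root_curve_map R n _ D F) Kr KS KT gen_t Kt.
have [psi psi_conj] := lang_automorphism sK s'K lang.
by exists psi; apply: reidemeister_lt_pinfty.
Qed.
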